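(* Let $X$ be a Banach space with basis $(x_i)_{i=1}^\infty$. Then every normalized block basic sequence of $(x_i)$ is good if and only if $X$ is stabilized $1$-asymptotic $\ell_p$ (with respect to $(x_i)$) for some $1\leq p\leq\infty$. In particular, such a space is isomorphic to an $\ell_p$-sum of finite dimensional spaces (a $c_0$-sum of finite dimensional spaces in the case $p=\infty$).
   Context: Scalars are real; bases and basic sequences are Schauder. Equivalence: for $C\geq 1$, two sequences $(u_i)$, $(v_i)$ (finite of the same length, or both infinite) are $C$-equivalent if $\frac1C\|\sum a_i v_i\|\leq\|\sum a_i u_i\|\leq C\|\sum a_i v_i\|$ for all finitely supported scalars $(a_i)$. For a finite-dimensional space $E$ with a fixed basis $(e_i)_{i=1}^n$, $E\stackrel{C}{\sim}\ell_p^n$ means that $(e_i)_{i=1}^n$ is $C$-equivalent to the unit vector basis of $\ell_p^n$, and $(y_i)_{i=1}^n\stackrel{C}{\sim}E$ means that $(y_i)_{i=1}^n$ is $C$-equivalent to $(e_i)_{i=1}^n$. A block (basic) sequence of $(x_i)$ is a finite or infinite sequence of nonzero finitely supported vectors $y_j$ in the span of $(x_i)$ with $\max\operatorname{supp}(y_j)<\min\operatorname{supp}(y_{j+1})$, supports being taken with respect to $(x_i)$. Good sequence: a normalized basic sequence $(y_i)$ is good if for every $n\in\mathbb{N}$ and all scalars $(a_i)_{i=1}^n$ the limit $\lim_{k_1\to\infty}\|\sum_{i=1}^n a_i y_{k_i}\|$ (over $k_1<k_2<\cdots<k_n$) exists. Asymptotic structure: let $S(Y)$ denote the unit sphere of $Y$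 and $[x_i]_{i=m}^\infty$ the closed linear span of $\{x_i:i\geq m\}$. An $n$-dimensional Banach space $E$ with basis $(e_i)_{i=1}^n$ is an asymptotic space for $X$ (relative to $(x_i)$) if for every $\epsilon>0$: $\forall m_1\in\mathbb{N}\ \exists y_1\in S([x_i]_{i=m_1}^\infty)\ \cdots\ \forall m_n\in\mathbb{N}\ \exists y_n\in S([x_i]_{i=m_n}^\infty)$ such that $(y_i)_{i=1}^n$ is a block sequence of $(x_i)$ and is $(1+\epsilon)$-equivalent to $(e_i)_{i=1}^n$. The collection of these is denoted $\{X\}_n$. $X$ is $C$-asymptotic $\ell_p$ if $E\stackrel{C}{\sim}\ell_p^n$ for all $n\in\mathbb{N}$ and all $E\in\{X\}_n$. $X$ is stabilized $C$-asymptotic $\ell_p$ (with respect to $(x_i)$) if it is $C$-asymptotic $\ell_p$ and, in addition, for all $n\in\mathbb{N}$ and $\epsilon>0$ there exists $N=N(n,\epsilon)$ such that for any normalized block vectors $(y_i)_{i=1}^n$ of $(x_i)$ with $\min\operatorname{supp}(y_1)>N$ there exists $E\in\{X\}_n$ with $(y_i)_{i=1}^n\stackrel{1+\epsilon}{\sim}E$. Equivalently: for every $n\in\mathbb{N}$ and $\epsilon>0$ there is $N=N(n,\epsilon)$ such that every normalized block sequence $(y_i)_{i=1}^n$ of $(x_i)$ with $\min\operatorname{supp}(y_1)\geq N$ is $(C+\epsilon)$-equivalent to the unit vector basis of $\ell_p^n$. *)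

(* Defs.v *)
(* MathComp-Analysis; indices of infinite sequences start at 0. *)
From HB Require Import structures.
From mathcomp Require Import all_boot all_order all_algebra.
From mathcomp Require Import all_classical all_reals all_analysis.

Set Implicit Arguments.
Unset Strict Implicit.
Unset Printing Implicit Defensive.

Import Order.TTheory GRing.Theory Num.Theory.
Import numFieldNormedType.Exports.

Local Open Scope classical_set_scope.
Local Open Scope ring_scope.

Section Bases.
Context {R : realType} {X : completeNormedModType R}.
Implicit Types (x : nat -> X) (v : X).

Definition expands x v : set (nat -> R) :=
  [set a | series (fun i => a i *: x i) @ \oo --> v].

Definition schauder_basis x : Prop := forall v, exists! a, expands x v a.

(* The default value is irrelevant when x is a Schauder basis. *)
Definition coord x v : nat -> R := xget (fun=> 0) (expands x v).

Definition supp x v : set nat := [set i | coord x v i != 0].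

Definition tail_span x (m : nat) : set X :=
  closure [set v | exists (q : nat) (a : nat -> R),
                     v = \sum_(m <= i < q) a i *: x i].

(* I is 'I_n for finite sequences and nat for infinite ones.  As the vectors
   are nonzero, requiring the support condition for all i < j or only for
   consecutive indices is the same. *)
Definition block_seq {d} {I : orderType d} x (y : I -> X) : Prop :=
  (forall i, y i != 0 /\ finite_set (supp x (y i))) /\
  (forall i j, (i < j)%O ->
     forall k l, supp x (y i) k -> supp x (y j) l -> (k < l)%N).

Definition normalized {I : Type} (y : I -> X) : Prop :=
  forall i, `|y i| = 1.

Definition good (y : nat -> X) : Prop :=
  forall (n : nat) (a : 'I_n -> R), exists L : R,
    forall eps : R, 0 < eps -> exists K : nat,
      forall k : 'I_n -> nat,
        (forall i j : 'I_n, (i < j)%N -> (k i < k j)%N) ->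
        (forall i : 'I_n, (K <= k i)%N) ->
        `| `|\sum_(i < n) a i *: y (k i)| - L| < eps.

End Bases.

Section Equivalence.
Context {R : realType} {n : nat}.

Definition comb_norm {E : normedModType R} (e : 'I_n -> E) (a : 'I_n -> R) : R :=
  `|\sum_(i < n) a i *: e i|.

(* The norm of \sum_i a_i u_i, u the unit vector basis of l_p^n, 1 <= p <= +oo
   (the value at p = -oo is junk). *)
Definition lp_norm (p : \bar R) (a : 'I_n -> R) : R :=
  match p with
  | r%:E => (\sum_(i < n) `|a i| `^ r) `^ r^-1
  | _ => \big[Num.max/0]_(i < n) `|a i|
  end.

(* C-equivalence of two sequences of length n, each given through the norms of
   its linear combinations (comb_norm e, or lp_norm p). *)
Definition equivalent (C : R) (M N : ('I_n -> R) -> R) : Prop :=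
  forall a, C^-1 * N a <= M a /\ M a <= C * N a.

Definition fin_basis {E : normedModType R} (e : 'I_n -> E) : Prop :=
  forall v : E, exists! a : 'I_n -> R, v = \sum_(i < n) a i *: e i.

End Equivalence.

Section Asymptotic.
Context {R : realType} {X : completeNormedModType R}.
Implicit Types (x : nat -> X).

(* forall m_1, exists y_1 in S([x_i]_(i >= m_1)), ..., forall m_n,
   exists y_n in S([x_i]_(i >= m_n)), P (s ++ [:: y_1; ...; y_n]) *)
Fixpoint game x (P : seq X -> Prop) (n : nat) (s : seq X) : Prop :=
  if n is n'.+1 then
    forall m : nat, exists y : X,
      [/\ tail_span x m y, `|y| = 1 & game x P n' (rcons s y)]
  else P s.

(* E, with basis e, belongs to {X}_n. *)
Definition asymptotic_space x {n : nat} {E : completeNormedModType R}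
    (e : 'I_n -> E) : Prop :=
  fin_basis e /\
  forall eps : R, 0 < eps ->
    game x (fun s => let y := fun i : 'I_n => nth 0 s i in
                     block_seq x y /\
                     equivalent (1 + eps) (comb_norm y) (comb_norm e))
         n [::].

Definition asymptotic_lp x (C : R) (p : \bar R) : Prop :=
  forall (n : nat) (E : completeNormedModType R) (e : 'I_n -> E),
    asymptotic_space x e -> equivalent C (comb_norm e) (lp_norm p).

Definition stabilized_asymptotic_lp x (C : R) (p : \bar R) : Prop :=
  asymptotic_lp x C p /\
  forall (n : nat) (eps : R), 0 < eps -> exists N : nat,
    forall y : 'I_n -> X, block_seq x y -> normalized y ->
      (forall i l, supp x (y i) l -> (N < l)%N) ->
      exists (E : completeNormedModType R) (e : 'I_n -> E),
        asymptotic_space x e /\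
        equivalent (1 + eps) (comb_norm y) (comb_norm e).

End Asymptotic.

Section Sums.
Context {R : realType}.

Definition finite_dim (E : normedModType R) : Prop :=
  exists (n : nat) (e : 'I_n -> E), fin_basis e.

Definition sum_norm (p : \bar R) (F : nat -> completeNormedModType R)
    (f : forall k, F k) : \bar R :=
  Lnorm counting p (fun k : nat => `|f k|%:E).

(* The l_p-sum of the F k for p < +oo, their c_0-sum for p = +oo. *)
Definition in_sum (p : \bar R) (F : nat -> completeNormedModType R)
    (f : forall k, F k) : Prop :=
  (sum_norm p f < +oo)%E /\
  (p = +oo%E -> (fun k => `|f k|) @ \oo --> (0 : R)).

(* A linear bijection T from X onto the sum, given by its coordinates T k, that
   is bounded in both directions (injectivity follows from the lower bound). *)
Definition isomorphic_to_sum (X : completeNormedModType R) (p : \bar R)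
    (F : nat -> completeNormedModType R) : Prop :=
  exists T : forall k, {linear X -> F k},
    [/\ forall v : X, in_sum p (fun k => T k v),
        forall f : forall k, F k, in_sum p f ->
          exists v : X, forall k, T k v = f k &
        exists2 C : R, 0 < C & forall v : X,
          ((C^-1 * `|v|)%:E <= sum_norm p (fun k => T k v))%E /\
          (sum_norm p (fun k => T k v) <= (C * `|v|)%:E)%E].

End Sums.

(* Main.v *)
From Pilot Require Import Defs.
From HB Require Import structures.
From mathcomp Require Import all_boot all_order all_algebra.
From mathcomp Require Import all_classical all_reals all_analysis.
From mathcomp Require Import ess_sup_inf ring lra zify.

(** Both properties are compared with a statement on pairs, [pairs_lp]: for each
    [C > 1], any two successive finitely supported vectors [u] and [v] far enough
    along the basis satisfy [`|u + v| = lp2 p `|u| `|v|] up to the factor [C].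

    Suppose that all normalized block sequences are good.  Chaining pairs of
    blocks into one block sequence shows that [`|a *: u + b *: v|] converges to a
    single limit [F a b] as the normalized pair [(u, v)] moves to infinity
    ([pair_limit]).  The function [F] is a norm on the plane, and it is
    unconditional since blocks may be replaced by their opposites.  Merging two of
    three blocks into one gives [F a (F b c) = F (F a b) c].  Such a norm is an
    l_p norm ([associative_norm_lp]): its value on [n] ones is multiplicative and
    monotone in [n], thus a power of [n], and this determines [F].  A compactness
    argument in one scalar makes the convergence uniform ([pairF_uniform]), which
    is [pairs_lp].

    From pairs one passes to [n] blocks by splitting off the first block
    repeatedly ([iterate_lp2]), the constants being multiplied.  With constants
    close enough to 1 this gives almost isometric copies of l_p^n
    ([pairs_tuples_lp]), which amounts to being stabilized 1-asymptotic l_p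
    ([tuples_stabilized], [stabilized_tuples]) and makes block sequences good
    ([tuples_good]).

    With constants [C k] whose product converges, the same iteration applies to
    infinitely many blocks: cutting the basis where the constant [C k] becomes
    valid decomposes the space into an l_p sum of finite-dimensional pieces, a
    c_0 sum if [p = +oo]
    ([block_estimate], [pairs_lp_decomposition]).

    Coordinates must be continuous throughout, that is, the basis constant must be
    finite; this is derived from Baire's theorem ([basis_constant]). *)

Import Order.TTheory GRing.Theory Num.Theory.
Import numFieldNormedType.Exports.

Local Open Scope classical_set_scope.
Local Open Scope ring_scope.

Set Implicit Arguments.
Unset Strict Implicit.
Unset Printing Implicit Defensive.

(* [coord] also denotes the coordinates with respect to a finite family in a
   vector space; here it is always the Schauder coordinate. *)
Local Notation coord := Pilot.Defs.coord.

(** * Finite-dimensional spaces with a prescribed norm *)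

(** A norm on [R^n], given as a function of the coordinates.  The bound of the
    coordinates by the norm replaces both definiteness and the compactness
    argument by which completeness is usually proved. *)
Record coord_norm (R : realType) (n : nat) := CoordNorm {
  cn_fun :> ('I_n -> R) -> R;
  cn_const : R;
  cnD : forall a b, cn_fun (fun i => a i + b i) <= cn_fun a + cn_fun b;
  cnZ : forall t a, cn_fun (fun i => t * a i) = `|t| * cn_fun a;
  cn_coord : forall a i, `|a i| <= cn_const * cn_fun a }.

(** [R^n] with the norm [N]: a copy of the row vectors, which carry their own
    norm already. *)
Definition normed_coord {R : realType} {n : nat} (N : coord_norm R n) : Type :=
  'rV[R]_n.

Section NormedCoord.
Context {R : realType} {n : nat} (N : coord_norm R n).
Local Notation E := (normed_coord N).

HB.instance Definition _ := GRing.Lmodule.on E.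

(** The [i]-th coordinate of a vector, and the vector with given coordinates. *)
Definition ncentry (v : E) (i : 'I_n) : R := (v : 'rV[R]_n) 0 i.

Lemma ncentryD (u v : E) i : ncentry (u + v) i = ncentry u i + ncentry v i.
Proof. by rewrite /ncentry mxE. Qed.

Lemma ncentryZ t (v : E) i : ncentry (t *: v) i = t * ncentry v i.
Proof. by rewrite /ncentry mxE. Qed.

Lemma ncentryP (u v : E) : ncentry u =1 ncentry v -> u = v.
Proof. by move=> uv; apply/rowP => i; apply: uv. Qed.

Definition ncvec (a : 'I_n -> R) : E := \row_i a i.

Lemma ncvecE a i : ncentry (ncvec a) i = a i.
Proof. by rewrite /ncentry mxE. Qed.

Definition ncnorm (v : E) : R := N (ncentry v).

Lemma ncnormD (u v : E) : ncnorm (u + v) <= ncnorm u + ncnorm v.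
Proof.
suff -> : ncnorm (u + v) = N (fun i => ncentry u i + ncentry v i) by exact: cnD.
by congr (N _); apply/funext => i; rewrite ncentryD.
Qed.

Lemma ncnormZ (t : R) (v : E) : ncnorm (t *: v) = `|t| * ncnorm v.
Proof.
by rewrite /ncnorm -cnZ; congr (N _); apply/funext => i; rewrite ncentryZ.
Qed.

Lemma ncnorm_eq0 (v : E) : ncnorm v = 0 -> v = 0.
Proof.
move=> v0; apply: ncentryP => i; apply/eqP; rewrite /ncentry mxE -normr_le0.
by have := cn_coord N (ncentry v) i; rewrite [N _]v0 mulr0.
Qed.

HB.instance Definition _ := Lmodule_isNormed.Build R E ncnormD ncnormZ ncnorm_eq0.

Lemma ncnormE (v : E) : `|v| = N (ncentry v).
Proof. by []. Qed.

Lemma nc_sum (s : seq 'I_n) (f : 'I_n -> E) j :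
  ncentry (\sum_(i <- s) f i) j = \sum_(i <- s) ncentry (f i) j.
Proof. by elim/big_rec2: _ => [|i a b _ <-]; rewrite /ncentry mxE. Qed.

(** The unit vectors. *)
Definition ncbasis (i : 'I_n) : E := ncvec (fun j => (j == i)%:R).

Lemma nc_comb (a : 'I_n -> R) : \sum_(i < n) a i *: ncbasis i = ncvec a.
Proof.
apply: ncentryP => j; rewrite nc_sum (bigD1 j)//= big1 ?addr0.
  by rewrite ncentryZ !ncvecE eqxx mulr1.
by move=> i ij; rewrite ncentryZ ncvecE eq_sym (negbTE ij) mulr0.
Qed.

Lemma le_ncnorm_sum (v : E) :
  `|v| <= \sum_(i < n) `|ncentry v i| * `|ncbasis i|.
Proof.
suff {1}-> : v = \sum_(i < n) ncentry v i *: ncbasis i.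
  by apply: le_trans (ler_norm_sum _ _ _) _; apply: ler_sum => i _; rewrite normrZ.
by rewrite nc_comb; apply: ncentryP => i; rewrite ncvecE.
Qed.

(** A Cauchy filter converges coordinatewise, hence in norm. *)
Lemma nc_complete (F : set_system E) : ProperFilter F -> cauchy F -> cvg F.
Proof.
move=> FF Fc.
have /all_sig [l lP] : forall i, {l : R | (fun v => ncentry v i) @ F --> l}.
  move=> i; apply: cid; apply/cvg_ex; apply: cauchy_cvg.
  apply: cauchy_exP => e e0.
  have c0 : 0 < `|cn_const N| + 1 by rewrite ltr_wpDl.
  move/cauchyP: Fc => /(_ (e / (`|cn_const N| + 1))) [|v Fv].
    by rewrite divr_gt0.
  exists (ncentry v i).
  suff : F [set w | ball (ncentry v i) e (ncentry w i)] by [].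
  apply: filterS Fv => w.
  rewrite -!ball_normE /ball_/= ltr_pdivlMr// => vw.
  have := cn_coord N (ncentry (v - w)) i.
  rewrite [X in `|X|](_ : _ = ncentry v i - ncentry w i); last first.
    by rewrite /ncentry !mxE.
  move=> h; apply: le_lt_trans h _; apply: le_lt_trans vw.
  rewrite mulrC ler_wpM2l// ?ncnormE//.
    exact: (normr_ge0 (v - w)).
  by rewrite (le_trans (ler_norm _))// lerDl.
apply/cvg_ex; exists (ncvec l : E); apply/cvgrPdist_lt => e e0.
pose M := \sum_(i < n) `|ncbasis i|.
have M0 : 0 <= M by apply: sumr_ge0.
have eM : 0 < e / (M + 1) by rewrite divr_gt0// ltr_wpDl.
have : \forall v \near F, forall i, `|l i - ncentry v i| < e / (M + 1).
  by apply: filter_forall => i; move/cvgrPdist_lt: (lP i) => /(_ _ eM).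
apply: filterS => v lv; apply: le_lt_trans (le_ncnorm_sum _) _.
apply: (@le_lt_trans _ _ (e / (M + 1) * M)).
  rewrite mulr_sumr; apply: ler_sum => i _; apply: ler_wpM2r => //.
  apply: le_trans (ltW (lv i)).
  by rewrite /ncentry !mxE.
by rewrite mulrAC ltr_pdivrMr ?ltr_wpDl// ltr_pM2l// ltrDl.
Qed.

HB.instance Definition _ := Uniform_isComplete.Build E nc_complete.

Lemma ncbasisP : fin_basis ncbasis.
Proof.
move=> v; exists (ncentry v); split.
  by rewrite nc_comb; apply: ncentryP => i; rewrite ncvecE.
by move=> a ->; rewrite nc_comb; apply/funext => i; rewrite ncvecE.
Qed.

Lemma comb_norm_ncbasis (a : 'I_n -> R) : comb_norm ncbasis a = N a.
Proof.
rewrite /comb_norm nc_comb ncnormE; congr (N _).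
by apply/funext => i; rewrite ncvecE.
Qed.

End NormedCoord.

(** * Coordinates with respect to a Schauder basis *)
Section BasisCoordinates.
Context {R : realType} {X : completeNormedModType R}.
Variables (x : nat -> X) (hx : schauder_basis x).
Implicit Types (u v w : X) (a b : nat -> R).

Lemma expandsP v a : expands x v a <->
  (forall e, 0 < e -> exists N, forall n, (N <= n)%N ->
    `|v - \sum_(0 <= i < n) a i *: x i| < e).
Proof.
split=> [/cvgrPdist_lt h e e0|h].
  by have [N _ hN] := h _ e0; exists N => n /hN.
by apply/cvgrPdist_lt => e /h [N hN]; exists N => // n /hN.
Qed.

Lemma expands_coord v : expands x v (coord x v).
Proof. by apply: xgetPex; have [a [? _]] := hx v; exists a. Qed.

Lemma coord_uniq v a : expands x v a -> coord x v = a.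
Proof.
move=> va; have [b [_ hb]] := hx v.
by rewrite -(hb _ va) -(hb _ (@expands_coord v)).
Qed.

Lemma coordD u v : coord x (u + v) = fun i => coord x u i + coord x v i.
Proof.
apply: coord_uniq; rewrite /expands/=.
rewrite (_ : series _ = series (fun i => coord x u i *: x i) +
                        series (fun i => coord x v i *: x i)).
  exact: cvgD (@expands_coord u) (@expands_coord v).
apply/funext => n; rewrite fctE /series/= -big_split/=.
by apply: eq_bigr => i _; rewrite scalerDl.
Qed.

Lemma coordZ t v : coord x (t *: v) = fun i => t * coord x v i.
Proof.
apply: coord_uniq; rewrite /expands/=.
rewrite (_ : series _ = fun n => t *: series (fun i => coord x v i *: x i) n).
  by exact: cvgZl_tmp (@expands_coord v).
apply/funext => n; rewrite /series/= scaler_sumr.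
by apply: eq_bigr => i _; rewrite scalerA.
Qed.

Lemma coordDE u v i : coord x (u + v) i = coord x u i + coord x v i.
Proof. by rewrite coordD. Qed.

Lemma coordZE t v i : coord x (t *: v) i = t * coord x v i.
Proof. by rewrite coordZ. Qed.

Lemma coord0 i : coord x 0 i = 0.
Proof. by rewrite -(scale0r 0) coordZE mul0r. Qed.

Lemma coordNE v i : coord x (- v) i = - coord x v i.
Proof. by rewrite -scaleN1r coordZE mulN1r. Qed.

Lemma coord_sum (I : Type) (s : seq I) (P : pred I) (f : I -> X) i :
  coord x (\sum_(k <- s | P k) f k) i = \sum_(k <- s | P k) coord x (f k) i.
Proof.
by elim/big_rec2: _ => [|k c w _ <-]; rewrite ?coord0// coordDE.
Qed.

Lemma coord_basis k i : coord x (x k) i = (i == k)%:R.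
Proof.
suff -> : coord x (x k) = fun i => (i == k)%:R by [].
apply: coord_uniq; apply/expandsP => e e0; exists k.+1 => n kn.
rewrite big_mkord (bigD1 (Ordinal kn))//= eqxx scale1r big1 ?addr0 ?subrr ?normr0//.
by move=> j; rewrite -val_eqE/= => /negbTE ->; rewrite scale0r.
Qed.

Lemma basis_neq0 k : x k != 0.
Proof.
apply/eqP => xk; have := coord_basis k k.
by rewrite xk coord0 eqxx => /esym/eqP; rewrite oner_eq0.
Qed.

(** [v] is a linear combination of the [x i] with [m <= i < q]. *)
Definition inspan m q v := forall i, ~~ (m <= i < q)%N -> coord x v i = 0.

(** The projection onto the span of the [x i] with [m <= i < q]. *)
Definition proj m q v := \sum_(m <= i < q) coord x v i *: x i.

Lemma coord_psum m q a i :
  coord x (\sum_(m <= k < q) a k *: x k) i = if (m <= i < q)%N then a i else 0.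
Proof.
rewrite coord_sum; under eq_bigr do rewrite coordZE coord_basis.
have [h|h] := ifP.
  rewrite (bigD1_seq i) ?mem_index_iota ?iota_uniq//= eqxx mulr1.
  by rewrite big1 ?addr0// => k /negbTE; rewrite eq_sym => ->; rewrite mulr0.
rewrite big_nat_cond big1// => k; rewrite andbT => hk.
by case: eqP hk h => [->->|_ _ _]//; rewrite mulr0.
Qed.

Lemma coord_inj u v : (forall i, coord x u i = coord x v i) -> u = v.
Proof.
move=> uv; have := @expands_coord u.
rewrite (_ : coord x u = coord x v); last exact/funext.
by move=> h; apply: cvg_unique h (@expands_coord v).
Qed.

Lemma inspan_proj m q v : inspan m q v -> v = proj m q v.
Proof.
move=> h; apply: coord_inj => i; rewrite coord_psum.
by case: ifPn => // /h.
Qed.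

Lemma inspanD m q u v : inspan m q u -> inspan m q v -> inspan m q (u + v).
Proof. by move=> hu hv i hi; rewrite coordDE hu// hv// addr0. Qed.

Lemma inspanZ m q t v : inspan m q v -> inspan m q (t *: v).
Proof. by move=> hv i hi; rewrite coordZE hv// mulr0. Qed.

Lemma inspan0 m q : inspan m q 0.
Proof. by move=> i _; rewrite coord0. Qed.

Lemma inspan_sum m q (I : Type) (s : seq I) (P : pred I) (f : I -> X) :
  (forall i, P i -> inspan m q (f i)) -> inspan m q (\sum_(k <- s | P k) f k).
Proof.
by move=> h; apply: big_ind => //; [exact: inspan0|exact: inspanD].
Qed.

Lemma inspan_basis k : inspan k k.+1 (x k).
Proof. by move=> i; rewrite coord_basis ltnS -eqn_leq eq_sym => /negbTE ->. Qed.

Lemma inspan_sub m q m' q' v : (m' <= m)%N -> (q <= q')%N ->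
  inspan m q v -> inspan m' q' v.
Proof.
move=> mm qq h i hi; apply: h; apply: contra hi => /andP[h1 h2].
by rewrite (leq_trans mm h1) (leq_trans h2 qq).
Qed.

Lemma proj_cvg v e : 0 < e -> exists N, forall n, (N <= n)%N -> `|v - proj 0 n v| < e.
Proof. by move: e; apply/expandsP; apply: expands_coord. Qed.

Lemma projB m q u v : proj m q (u - v) = proj m q u - proj m q v.
Proof.
rewrite /proj -sumrB; apply: eq_bigr => i _.
by rewrite coordDE coordNE scalerBl.
Qed.

Lemma projD m q u v : proj m q (u + v) = proj m q u + proj m q v.
Proof.
rewrite /proj -big_split; apply: eq_bigr => i _.
by rewrite coordDE scalerDl.
Qed.

Lemma projZ m q t v : proj m q (t *: v) = t *: proj m q v.
Proof.
rewrite /proj scaler_sumr; apply: eq_bigr => i _.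
by rewrite coordZE scalerA.
Qed.

Lemma partial_sums_bounded v : exists M, forall n, `|proj 0 n v| <= M.
Proof.
have [N hN] := @proj_cvg v 1 ltr01.
exists (\sum_(0 <= n < N) `|proj 0 n v| + (`|v| + 1)) => n.
have [nN|Nn] := ltnP n N.
  rewrite (bigD1_seq n) ?mem_index_iota ?iota_uniq//= -addrA lerDl.
  by rewrite !addr_ge0// sumr_ge0.
apply: le_trans (_ : `|v| + 1 <= _); last by rewrite lerDr sumr_ge0.
rewrite -[X in `|X|](subKr v); apply: le_trans (ler_normB _ _) _.
by rewrite lerD2l ltW// hN.
Qed.

End BasisCoordinates.

(** * The basis constant *)
Lemma cauchy_lim (R : realType) (V : completeNormedModType R) (u : nat -> V) :
  (forall e, 0 < e -> exists N, forall n, (N <= n)%N -> `|u N - u n| < e) ->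
  exists l, forall e, 0 < e -> exists N, forall n, (N <= n)%N -> `|l - u n| < e.
Proof.
move=> h; have /cvg_ex[l /cvgrPdist_lt ul] : cvg (u @ \oo).
  apply: cauchy_cvg; apply: cauchy_exP => e /h [N hN].
  by exists (u N); exists N => // n /hN; rewrite -ball_normE.
by exists l => e /ul [N _ hN]; exists N => n /hN.
Qed.

Section BasisConstant.
Context {R : realType} {X : completeNormedModType R}.
Variables (x : nat -> X) (hx : schauder_basis x).
Implicit Types (u v w : X).

(** The vectors whose partial sums are bounded by [k]. *)
Let A (k : nat) : set X := [set v | forall n, `|proj x 0 n v| <= k%:R].

Lemma closure_ballP (B : set X) v : closure B v <->
  forall e, 0 < e -> exists2 w, B w & `|v - w| < e.
Proof.
split=> [cB e e0|h C /nbhs_ballP [e e0 eC]].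
  have [w [Bw]] := cB _ (nbhsx_ballx v e e0).
  by rewrite -ball_normE => vw; exists w.
by have [w Bw vw] := h _ e0; exists w; split => //; apply: eC; rewrite -ball_normE.
Qed.

(** The sets [A k] cover the space; by Baire the closure of one of them
    contains a ball. *)
Lemma closure_bounded_interior : exists k v0 d, 0 < d /\
  forall w, `|v0 - w| < d -> closure (A k) w.
Proof.
apply: contrapT => hn.
have OA k : open (~` closure (A k)) /\ dense (~` closure (A k)).
  split; first exact/closed_openC/closed_closure.
  move=> O [v0 Ov0] oO; apply: contrapT => hO.
  have /nbhs_ballP [d d0 dO] : nbhs v0 O by exact: open_nbhs_nbhs.
  apply: hn; exists k, v0, d; split => // w vw; apply: contrapT => cw.
  by apply: hO; exists w; split => //; apply: dO; rewrite -ball_normE.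
have [||v [_ hv]] := Baire OA (O := setT).
- by exists 0.
- exact: openT.
have [M hM] := partial_sums_bounded hx v.
apply: (hv (Num.bound `|M|)) => //; apply: subset_closure => n.
by apply: le_trans (hM n) _; apply/ltW/(le_lt_trans (ler_norm _)); rewrite archi_boundP// normr_ge0.
Qed.

(** Differences of elements of [A k] are dense in a ball around the origin. *)
Lemma approx_bounded : exists2 C, 0 <= C & forall w e, 0 < e ->
  exists2 a, `|w - a| < e & forall n, `|proj x 0 n a| <= C * `|w|.
Proof.
have [k [v0 [d [d0 hd]]]] := closure_bounded_interior.
exists (4 * k%:R / d) => [|w e e0].
  by rewrite divr_ge0 ?mulr_ge0// ltW.
have [->|w0] := eqVneq w 0.
  exists 0; first by rewrite subr0 normr0.
  by move=> n; rewrite /proj big1 ?normr0 ?mulr0// => i _; rewrite coord0// scale0r.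
have nw0 : 0 < `|w| by rewrite normr_gt0.
(* rescale w into the ball of radius d *)
pose t := 2 * `|w| / d.
have t0 : 0 < t by rewrite divr_gt0// mulr_gt0.
have e2 : 0 < e / t / 2 by rewrite divr_gt0// divr_gt0.
have /closure_ballP/(_ _ e2) [a Aa ha] : closure (A k) v0.
  by apply: hd; rewrite subrr normr0.
have /closure_ballP/(_ _ e2) [b Ab hb] : closure (A k) (v0 + t^-1 *: w).
  apply: hd; rewrite opprD addNKr normrN normrZ ger0_norm ?invr_ge0 ?ltW//.
  rewrite /t invf_div mulrAC ltr_pdivrMr; last by rewrite mulr_gt0.
  by rewrite ltr_pM2l// mulrC ltr_pMr// ltr1n.
exists (t *: (b - a)).
  have -> : w - t *: (b - a) = t *: ((v0 + t^-1 *: w - b) - (v0 - a)).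
    have -> : v0 + t^-1 *: w - b - (v0 - a) = t^-1 *: w - (b - a).
      by rewrite [v0 + _]addrC -!addrA; congr (_ + _); rewrite !opprB addrCA [a - v0]addrC addNKr addrC.
    by rewrite [RHS]scalerBr scalerA divff ?gt_eqF// scale1r.
  rewrite normrZ gtr0_norm// mulrC -ltr_pdivlMr//.
  apply: le_lt_trans (ler_normB _ _) _.
  by rewrite [ltRHS]splitr ltrD.
move=> n; rewrite projZ// projB// normrZ gtr0_norm//.
apply: le_trans (_ : t * (k%:R + k%:R) <= _).
  by rewrite ler_pM2l//; apply: le_trans (ler_normB _ _) _; apply: lerD.
by rewrite /t le_eqVlt; apply/orP; left; apply/eqP; field; rewrite gt_eqF.
Qed.

(** The partial sum projections are uniformly bounded.  As in the proof of the
    open mapping theorem, a vector is written as a rapidly convergent series of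
    vectors with controlled partial sums; uniqueness of the expansion identifies
    the sum of the coordinates of the terms with those of the vector. *)
Lemma basis_constant : exists2 K, 0 < K & forall v n, `|proj x 0 n v| <= K * `|v|.
Proof.
have [C C0 hC] := approx_bounded.
suff h : forall v n, `|proj x 0 n v| <= 2 * C * `|v|.
  exists (2 * C + 1) => [|v n]; first by rewrite ltr_wpDl// mulr_ge0.
  by apply: le_trans (h v n) _; rewrite ler_wpM2r// lerDl.
move=> v; have [->|v0] := eqVneq v 0.
  by move=> n; rewrite /proj big1 ?normr0 ?mulr0// => i _; rewrite coord0// scale0r.
have nv0 : 0 < `|v| by rewrite normr_gt0.
pose r j := `|v| / 2 ^+ j.
have r0 j : 0 < r j by rewrite divr_gt0// exprn_gt0.
have /choice [g gP] : forall jw : nat * X, exists a, `|jw.2 - a| < r jw.1.+1 /\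
    forall n, `|proj x 0 n a| <= C * `|jw.2|.
  by move=> [j w]; have [a ? ?] := hC w _ (r0 j.+1); exists a.
(* w_ j is what remains of v after j approximations, s_ j their sum *)
pose w_ := fix w_ j := if j is j'.+1 then w_ j' - g (j', w_ j') else v.
pose s_ j := v - w_ j.
have w_le j : `|w_ j| <= r j.
  case: j => [|j]; first by rewrite /r expr0 divr1.
  exact/ltW/(gP (j, w_ j)).1.
have sS j : s_ j.+1 = s_ j + g (j, w_ j).
  by rewrite /s_/= opprB addrCA addrC.
have projS n j d : `|proj x 0 n (s_ (j + d)%N) - proj x 0 n (s_ j)|
                 <= 2 * C * (r j - r (j + d)%N).
  elim: d => [|d ih]; first by rewrite addn0 !subrr normr0 mulr0.
  rewrite addnS sS projD// addrAC; apply: le_trans (ler_normD _ _) _.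
  apply: le_trans (lerD ih ((gP (_, _)).2 n)) _ => /=.
  have -> : r (j + d).+1 = r (j + d)%N / 2.
    by rewrite /r exprSr invfM mulrA.
  have := ler_wpM2l C0 (w_le (j + d)%N); set a := r _; set b := `|w_ _|.
  by move=> h; rewrite -subr_ge0; lra.
have projC n i j : (i <= j)%N ->
    `|proj x 0 n (s_ j) - proj x 0 n (s_ i)| <= 2 * C * r i.
  move=> ij; rewrite -(subnKC ij); apply: le_trans (projS _ _ _) _.
  by rewrite ler_wpM2l ?mulr_ge0// gerBl ltW.
have rcvg e : 0 < e -> exists j, r j < e.
  move=> e0; exists (Num.bound (`|v| / e)).
  rewrite /r ltr_pdivrMr ?exprn_gt0// mulrC -ltr_pdivrMr//.
  apply: lt_trans (archi_boundP _) _; first by rewrite divr_ge0// ltW.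
  by rewrite -natrX ltr_nat ltn_expl.
(* the coordinates of the s_ j converge to some c, and c expands v *)
have coordC i j k : (j <= k)%N ->
    `|coord x (s_ j) i - coord x (s_ k) i| <= 4 * C * r j / `|x i|.
  have x0 : 0 < `|x i| by rewrite normr_gt0 basis_neq0.
  move=> jk; rewrite ler_pdivlMr// -normrZ.
  have -> : (coord x (s_ j) i - coord x (s_ k) i) *: x i =
      (proj x 0 i.+1 (s_ j) - proj x 0 i.+1 (s_ k)) -
      (proj x 0 i (s_ j) - proj x 0 i (s_ k)).
    by rewrite -!projB// {1}/proj big_nat_recr//= addrAC subrr add0r coordDE// coordNE.
  apply: le_trans (ler_normB _ _) _.
  rewrite distrC [X in _ + X]distrC.
  by apply: le_trans (lerD (projC _ _ _ jk) (projC _ _ _ jk)) _; lra.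
have /choice [c cP] : forall i, exists l, forall e, 0 < e -> exists N, forall n,
    (N <= n)%N -> `|l - coord x (s_ n) i| < e.
  move=> i; apply: (@cauchy_lim R R) => e e0.
  have x0 : 0 < `|x i| by rewrite normr_gt0 basis_neq0.
  have C1 : 0 < 4 * C + 1 by rewrite ltr_wpDl// mulr_ge0.
  have [j jP] := rcvg (e * `|x i| / (4 * C + 1)) (divr_gt0 (mulr_gt0 e0 x0) C1).
  exists j => n jn; apply: le_lt_trans (coordC _ _ _ jn) _.
  rewrite ltr_pdivrMr//; move: jP; rewrite ltr_pdivlMr//.
  by apply: le_lt_trans; rewrite mulrC ler_pM2l// lerDl.
have psum_cvg n : forall e, 0 < e -> exists k0, forall k, (k0 <= k)%N ->
    `|\sum_(0 <= i < n) c i *: x i - proj x 0 n (s_ k)| < e.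
  elim: n => [|n ih] e e0.
    by exists 0 => k _; rewrite /proj !big_geq// subrr normr0.
  have x0 : 0 < `|x n| by rewrite normr_gt0 basis_neq0.
  have e2 : 0 < e / 2 by rewrite divr_gt0.
  have [k1 k1P] := ih _ e2.
  have [k2 k2P] := cP n (e / 2 / `|x n|) (divr_gt0 e2 x0).
  exists (maxn k1 k2) => k; rewrite geq_max => /andP[kk1 kk2].
  rewrite /proj !big_nat_recr//= opprD addrACA -scalerBl.
  apply: le_lt_trans (ler_normD _ _) _; rewrite (splitr e) ltrD ?k1P//.
  by rewrite normrZ -ltr_pdivlMr// k2P.
have limP n j : `|\sum_(0 <= i < n) c i *: x i - proj x 0 n (s_ j)| <= 2 * C * r j.
  apply/ler_addgt0Pr => e e0; have [k0 k0P] := psum_cvg n e e0.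
  pose k := maxn k0 j.
  rewrite -(subrK (proj x 0 n (s_ k)) (\sum_(0 <= i < n) _)) -addrA addrC.
  apply: le_trans (ler_normD _ _) _; apply: lerD; first exact: projC (leq_maxr _ _).
  by apply/ltW/k0P/leq_maxl.
have cE : coord x v = c.
  apply: coord_uniq => //; apply/expandsP => // e e0.
  have C1 : 0 < 2 * C + 1 by rewrite ltr_wpDl// mulr_ge0.
  have e3 : 0 < e / 3 by rewrite divr_gt0.
  have [j jP] := rcvg (e / 3 / (2 * C + 1)) (divr_gt0 e3 C1).
  move: jP; rewrite ltr_pdivlMr// => jP.
  have Cr : 2 * C * r j < e / 3.
    by apply: le_lt_trans jP; rewrite mulrC ler_pM2l// lerDl.
  have rj : r j < e / 3.
    by apply: le_lt_trans jP; rewrite ler_peMr ?(ltW (r0 j))// lerDr mulr_ge0.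
  have [N hN] := proj_cvg hx (s_ j) e3.
  exists N => n /hN; move: (limP n j) (w_le j).
  have -> : w_ j = v - s_ j by rewrite /s_ subKr.
  set a := (\sum_(0 <= i < n) _); set b := proj _ _ _ _; set s := s_ j => h1 h2 h3.
  apply: le_lt_trans (ler_distD s _ _) _.
  apply: le_lt_trans (lerD (lexx _) (ler_distD b _ _)) _.
  by rewrite [`|b - a|]distrC; lra.
move=> n; rewrite /proj cE; have := limP n 0.
have -> : s_ 0 = 0 by rewrite /s_ subrr.
by rewrite /r expr0 divr1 [proj _ _ _ 0]big1 ?subr0// => i _; rewrite coord0// scale0r.
Qed.

End BasisConstant.

(** * Supports and block sequences *)
Section Supports.
Context {R : realType} {X : completeNormedModType R}.
Variables (x : nat -> X) (hx : schauder_basis x).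
Implicit Types (u v w : X).

Lemma proj_bound : exists2 K, 0 < K & forall v m q, `|proj x m q v| <= K * `|v|.
Proof.
have [K K0 hK] := basis_constant hx; exists (2 * K); first by rewrite mulr_gt0.
move=> v m q; have [qm|mq] := leqP q m.
  by rewrite /proj big_geq// normr0 mulr_ge0// ltW// mulr_gt0.
have -> : proj x m q v = proj x 0 q v - proj x 0 m v.
  by rewrite /proj [X in X - _](big_cat_nat (n := m))//= ?(ltnW mq)// addrAC subrr add0r.
apply: le_trans (ler_normB _ _) _.
by rewrite -mulrA mulr2n mulrDl mul1r lerD.
Qed.

Lemma coord_bound i : exists2 c, 0 < c & forall v, `|coord x v i| <= c * `|v|.
Proof.
have [K K0 hK] := proj_bound.
have x0 : 0 < `|x i| by rewrite normr_gt0 basis_neq0.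
exists (K / `|x i|) => [|v]; first by rewrite divr_gt0.
rewrite mulrAC ler_pdivlMr// -normrZ.
by have := hK v i i.+1; rewrite /proj big_nat1.
Qed.

Lemma coord_lim v i (c : R) :
  (forall e, 0 < e -> exists2 w, `|v - w| < e & coord x w i = c) -> coord x v i = c.
Proof.
move=> h; have [C C0 hC] := coord_bound i.
apply/eqP; rewrite -subr_eq0 -normr_le0; apply/ler_addgt0Pl => e e0; rewrite addr0.
have [w vw <-] := h _ (divr_gt0 e0 C0).
rewrite -coordNE// -coordDE//; apply: le_trans (hC _) _.
by rewrite mulrC -ler_pdivlMr// ltW.
Qed.

Lemma tail_span_coord m v i : tail_span x m v -> (i < m)%N -> coord x v i = 0.
Proof.
move=> /closure_ballP h im; apply: coord_lim => e /h [w [q [a ->]] vw].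
by exists (\sum_(m <= i < q) a i *: x i) => //; rewrite coord_psum// leqNgt im.
Qed.

Lemma inspan_tail_span m q v : inspan x m q v -> tail_span x m v.
Proof.
by move=> /(inspan_proj hx) ->; apply: subset_closure; exists q, (coord x v).
Qed.

Lemma supp_bounds v : v != 0 -> finite_set (supp x v) ->
  exists lo hi, [/\ inspan x lo hi.+1 v, coord x v lo != 0 & coord x v hi != 0].
Proof.
move=> v0 fv.
have ex : exists i, coord x v i != 0.
  apply: contrapT => h; move/eqP: v0; apply; apply: (coord_inj hx) => i.
  by rewrite coord0//; apply/eqP; apply: contrapT => /negP hi; apply: h; exists i.
have ub i : coord x v i != 0 -> (i <= \max_(j <- finmap.enum_fset (fset_set (supp x v))) j)%N.
  move=> hi; apply: (@leq_bigmax_seq _ _ _ id) => //.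
  by rewrite in_fset_set// inE.
exists (ex_minn ex), (ex_maxn ex ub).
case: ex_minnP => lo hlo lomin; case: ex_maxnP => hi hhi himax; split=> // i hi'.
apply/eqP; apply: contraNT hi' => h; by rewrite lomin//= ltnS himax.
Qed.

Lemma inspan_finite_supp m q v : inspan x m q v -> finite_set (supp x v).
Proof.
move=> h; apply: (@sub_finite_set _ _ `I_q); last exact: finite_II.
move=> i /= vi; apply: contraT => iq; move/negP: vi; case; apply/eqP/h.
by rewrite negb_and iq orbT.
Qed.

Lemma inspan_supp m q v i : inspan x m q v -> coord x v i != 0 -> (m <= i < q)%N.
Proof. by move=> h vi; apply: contraT => /h /eqP; rewrite (negbTE vi). Qed.

(** Block sequences through the intervals [lo i, hi i) that contain the
    supports; the lower ends may be taken in the supports. *)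
Lemma block_seqI d (I : orderType d) (y : I -> X) (lo hi : I -> nat) :
  (forall i, y i != 0) -> (forall i, inspan x (lo i) (hi i) (y i)) ->
  (forall i j, (i < j)%O -> (hi i <= lo j)%N) -> block_seq x y.
Proof.
move=> y0 hy hij; split=> [i|i j ij k l].
  by split=> //; apply: inspan_finite_supp (hy i).
move=> /(inspan_supp (hy i))/andP[_ k1] /(inspan_supp (hy j))/andP[l1 _].
by apply: leq_trans k1 (leq_trans (hij _ _ ij) l1).
Qed.

Lemma block_seqE d (I : orderType d) (y : I -> X) : block_seq x y ->
  exists lo hi : I -> nat, [/\ forall i, inspan x (lo i) (hi i) (y i),
    forall i, supp x (y i) (lo i) & forall i j, (i < j)%O -> (hi i <= lo j)%N].
Proof.
move=> [h1 h2]; have /choice [lh lhP] : forall i, exists lh : nat * nat,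
   [/\ inspan x lh.1 lh.2.+1 (y i), coord x (y i) lh.1 != 0 & coord x (y i) lh.2 != 0].
  by move=> i; have [lo [hi h]] := supp_bounds (h1 i).1 (h1 i).2; exists (lo, hi).
exists (fun i => (lh i).1), (fun i => (lh i).2.+1); split.
- by move=> i; have [] := lhP i.
- by move=> i; have [_ + _] := lhP i.
- by move=> i j ij; apply: (h2 _ _ ij); have [] := lhP i; have [] := lhP j.
Qed.

(** The normalized basis vectors. *)
Definition nbasis k : X := `|x k|^-1 *: x k.

Lemma nbasis_norm k : `|nbasis k| = 1.
Proof.
by rewrite normrZ normfV normr_id mulVf// normr_eq0 basis_neq0.
Qed.

Lemma inspan_nbasis k : inspan x k k.+1 (nbasis k).
Proof. by apply: inspanZ => //; apply: inspan_basis. Qed.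

Lemma norm1_neq0 v : `|v| = 1 -> v != 0.
Proof. by move=> v1; rewrite -normr_eq0 v1 oner_eq0. Qed.

End Supports.

Arguments inspan_nbasis {R X x} hx k [i] _.

(** * The l_p norm as an iterated two-term norm *)
Section TwoTermNorm.
Context {R : realType}.
Implicit Types (p : \bar R) (r s t : R).

(** The norm of [(s, t)] in the two-dimensional l_p; the value at [p = -oo] is
    junk, and agrees with that of [lp_norm]. *)
Definition lp2 p s t : R :=
  match p with
  | r%:E => (`|s| `^ r + `|t| `^ r) `^ r^-1
  | _ => Num.max `|s| `|t|
  end.

(** The l_p norm of the terms of [a] with index in [m, n). *)
Definition lpn p (a : nat -> R) m n : R :=
  match p with
  | r%:E => (\sum_(m <= i < n) `|a i| `^ r) `^ r^-1
  | _ => \big[Num.max/0]_(m <= i < n) `|a i|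
  end.

(** [s] and [t] agree up to the factor [C]; [equivalent] asserts this of the
    norms of all linear combinations. *)
Definition within (C s t : R) : Prop := C^-1 * t <= s /\ s <= C * t.

Lemma lp_normE p n (a : nat -> R) :
  lp_norm p (fun i : 'I_n => a i) = lpn p a 0 n.
Proof. by case: p => [r| |] /=; rewrite big_mkord. Qed.

Lemma lee1_gt0 r : (1 <= r%:E)%E -> 0 < r.
Proof. by rewrite lee_fin; apply: lt_le_trans. Qed.

Lemma powRK r s : r != 0 -> 0 <= s -> (s `^ r) `^ r^-1 = s.
Proof. by move=> r0 s0; rewrite -powRrM divff// powRr1. Qed.

Lemma powRVK r s : r != 0 -> 0 <= s -> (s `^ r^-1) `^ r = s.
Proof. by move=> r0 s0; rewrite -powRrM mulVf// powRr1. Qed.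

Lemma lp2_ge0 p s t : 0 <= lp2 p s t.
Proof. by case: p => [r| |] /=; rewrite ?powR_ge0// le_max normr_ge0. Qed.

Lemma lpn_ge0 p a m n : 0 <= lpn p a m n.
Proof.
case: p => [r| |] /=; rewrite ?powR_ge0//.
all: by elim/big_rec: _ => // i u _ u0; rewrite le_max u0 orbT.
Qed.

Lemma lp2_max p s t : (1 <= p)%E -> Num.max `|s| `|t| <= lp2 p s t.
Proof.
case: p => [r| |]//= r1.
have r0 := lee1_gt0 r1.
rewrite ge_max; apply/andP; split.
  rewrite -{1}(@powRK r `|s|) ?gt_eqF//.
  by rewrite ge0_ler_powR ?nnegrE ?invr_ge0 ?(ltW r0)// ?addr_ge0 ?powR_ge0// lerDl powR_ge0.
rewrite -{1}(@powRK r `|t|) ?gt_eqF//.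
by rewrite ge0_ler_powR ?nnegrE ?invr_ge0 ?(ltW r0)// ?addr_ge0 ?powR_ge0// lerDr powR_ge0.
Qed.

Lemma lp2_le p s t s' t' : (1 <= p)%E -> `|s| <= `|s'| -> `|t| <= `|t'| ->
  lp2 p s t <= lp2 p s' t'.
Proof.
case: p => [r| |] r1 ss tt; rewrite /lp2; last by [].
  have r0 := lee1_gt0 r1.
  by rewrite ge0_ler_powR ?nnegrE ?invr_ge0 ?(ltW r0)// ?addr_ge0 ?powR_ge0//
    lerD// ge0_ler_powR ?nnegrE ?(ltW r0).
by rewrite ge_max !le_max ss tt orbT.
Qed.

Lemma lp2Z p u s t : (1 <= p)%E -> 0 <= u -> lp2 p (u * s) (u * t) = u * lp2 p s t.
Proof.
case: p => [r| |]//= r1 u0; rewrite !normrM (ger0_norm u0).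
  have r0 := lee1_gt0 r1.
  rewrite !powRM// -mulrDr powRM ?addr_ge0 ?powR_ge0//.
  by rewrite powRK ?gt_eqF.
by rewrite maxr_pMr.
Qed.

Lemma lp2s0 p s : (1 <= p)%E -> lp2 p s 0 = `|s|.
Proof.
case: p => [r| |]//= r1; rewrite normr0; last by apply/max_idPl.
have r0 := lee1_gt0 r1.
by rewrite powR0 ?gt_eqF// addr0 powRK ?gt_eqF.
Qed.

Lemma lp20s p s : (1 <= p)%E -> lp2 p 0 s = `|s|.
Proof.
case: p => [r| |]//= r1; rewrite normr0; last by apply/max_idPr.
have r0 := lee1_gt0 r1.
by rewrite powR0 ?gt_eqF// add0r powRK ?gt_eqF.
Qed.

Lemma lpn_rec p a m n : (1 <= p)%E -> (m < n)%N ->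
  lpn p a m n = lp2 p (a m) (lpn p a m.+1 n).
Proof.
move=> p1 mn; have h := lpn_ge0 p a m.+1 n; rewrite /lp2 (ger0_norm h).
case: p p1 {h} => [r| |]//= r1; rewrite big_ltn//.
have r0 := lee1_gt0 r1.
by rewrite powRVK ?gt_eqF// sumr_ge0// => i _; rewrite powR_ge0.
Qed.

Lemma lpn_nil p a m n : (1 <= p)%E -> (n <= m)%N -> lpn p a m n = 0.
Proof.
case: p => [r| |]//= r1 nm; rewrite big_geq//.
have r0 := lee1_gt0 r1.
by rewrite powR0// gt_eqF ?invr_gt0.
Qed.

Lemma eq_lpn p a b m n : (forall i, (m <= i < n)%N -> `|a i| = `|b i|) ->
  lpn p a m n = lpn p b m n.
Proof.
move=> ab; case: p => [r| |]/=.
  by congr (_ `^ _); apply: eq_big_nat => i /ab ->.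
all: by apply: eq_big_nat => i /ab ->.
Qed.

Lemma within_lp2 p C s t t' : (1 <= p)%E -> 1 <= C -> 0 <= t -> 0 <= t' ->
  within C t t' -> within C (lp2 p s t) (lp2 p s t').
Proof.
move=> p1 C1 t0 t'0 [h1 h2]; have C0 : 0 < C by apply: lt_le_trans C1.
have Ci : 0 <= C^-1 by rewrite invr_ge0 ltW.
split; rewrite -lp2Z// ?(ltW C0)//; apply: lp2_le => //.
- by rewrite normrM (ger0_norm Ci) ler_piMl// invf_le1.
- by rewrite (ger0_norm t0) ger0_norm// mulr_ge0.
- by rewrite normrM (gtr0_norm C0) ler_peMl.
- by rewrite (ger0_norm t0) ger0_norm// mulr_ge0// ltW.
Qed.

Lemma within_trans C D s t u : 0 < C -> 0 < D ->
  within C s t -> within D t u -> within (C * D) s u.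
Proof.
move=> C0 D0 [h1 h2] [h3 h4]; split.
  by rewrite invfM -mulrA; apply: le_trans h1; rewrite ler_pM2l// invr_gt0.
by apply: le_trans h2 _; rewrite -mulrA ler_pM2l.
Qed.

Lemma within_le C D s t : 0 < C -> C <= D -> 0 <= t -> within C s t -> within D s t.
Proof.
move=> C0 CD t0 [h1 h2]; split.
  by apply: le_trans h1; rewrite ler_wpM2r// lef_pV2// posrE// (lt_le_trans C0).
by apply: le_trans h2 _; rewrite ler_wpM2r.
Qed.

Lemma prod_ge1 (C : nat -> R) m n : (forall k, 1 <= C k) ->
  1 <= \prod_(m <= k < n) C k.
Proof.
move=> h; elim/big_rec: _ => // i u _ u1.
by rewrite (le_trans u1)// ler_peMl ?h// (le_trans _ u1).
Qed.

(** If each [z k] together with the sum of its successors obeys the two-term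
    estimate, then the whole sum obeys the l_p estimate, and the constants
    multiply. *)
Lemma iterate_lp2 (V : normedModType R) p (z : nat -> V) (C : nat -> R) m n :
  (1 <= p)%E -> (forall k, 1 <= C k) ->
  (forall k, (m <= k < n)%N ->
    within (C k) `|z k + \sum_(k.+1 <= j < n) z j|
           (lp2 p `|z k| `|\sum_(k.+1 <= j < n) z j|)) ->
  within (\prod_(m <= k < n) C k) `|\sum_(m <= k < n) z k|
         (lpn p (fun k => `|z k|) m n).
Proof.
move=> p1 C1; have [d] := ubnP (n - m); elim: d m => // d ih m nmd h.
have [nm|mn] := leqP n m.
  by rewrite lpn_nil// !big_geq// normr0; split; rewrite mulr0.
rewrite lpn_rec// !(big_ltn mn).
have C0 k : 0 < C k by apply: lt_le_trans (C1 k).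
have P1 : 1 <= \prod_(m.+1 <= k < n) C k by exact: prod_ge1.
have P0 : 0 < \prod_(m.+1 <= k < n) C k by apply: lt_le_trans P1.
apply: within_trans => //; first by apply: h; rewrite leqnn.
apply: within_lp2 => //; first exact: lpn_ge0.
apply: ih => [|k /andP[mk kn]]; last by apply: h; rewrite kn (ltnW mk).
by rewrite subnS; move: nmd mn; lia.
Qed.

End TwoTermNorm.

(** * Associative two-term norms are l_p norms *)

(** A variant of a theorem of Bohnenblust in which commutativity is not assumed:
    a homogeneous, associative and monotone operation on the nonnegative reals
    with neutral element 0 and [F 1 1 <= 2] is the norm of a two-dimensional
    l_p. *)
Section AssociativeNorm.
Context {R : realType}.
Variable F : R -> R -> R.
Hypothesis FZ : forall t a b, 0 <= t -> F (t * a) (t * b) = t * F a b.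
Hypothesis FA : forall a b c, F a (F b c) = F (F a b) c.
Hypothesis Fs0 : forall a, 0 <= a -> F a 0 = a.
Hypothesis F0s : forall a, 0 <= a -> F 0 a = a.
Hypothesis F_le : forall a b a' b', 0 <= a -> a <= a' -> 0 <= b -> b <= b' ->
  F a b <= F a' b'.
Hypothesis F11 : F 1 1 <= 2.

(** [F] iterated on [n] ones.  It is additive for [F] by associativity and
    multiplicative by homogeneity. *)
Fixpoint onesF n : R := if n is n'.+1 then F 1 (onesF n') else 0.

Lemma onesF_ge0 n : 0 <= onesF n.
Proof.
elim: n => //= n ih.
by apply: le_trans (_ : F 1 0 <= _); rewrite ?Fs0// -{1}(Fs0 ler01) F_le.
Qed.

Lemma onesF1 : onesF 1 = 1. Proof. by rewrite /= Fs0. Qed.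

Lemma onesF_ge1 n : 1 <= onesF n.+1.
Proof. by rewrite /= -{1}(Fs0 ler01) F_le// onesF_ge0. Qed.

Lemma onesFD m n : onesF (m + n) = F (onesF m) (onesF n).
Proof.
elim: m => [|m ih]; first by rewrite F0s// onesF_ge0.
by rewrite addSn /= ih FA.
Qed.

Lemma onesFM m n : onesF (m * n) = onesF m * onesF n.
Proof.
elim: m => [|m ih]; first by rewrite mul0r.
rewrite mulSn onesFD ih /= [RHS]mulrC -FZ ?onesF_ge0// mulr1.
by rewrite mulrC.
Qed.

Lemma onesFX m n : onesF (m ^ n) = onesF m ^+ n.
Proof. by elim: n => [|n ih]; rewrite ?onesF1// expnS onesFM ih exprS. Qed.

Lemma onesF_le m n : (m <= n)%N -> onesF m <= onesF n.
Proof.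
move=> mn; rewrite -(subnKC mn) onesFD -{1}(Fs0 (onesF_ge0 m)).
by rewrite F_le// onesF_ge0.
Qed.

(** The Archimedean property, in the form used to show that two quantities
    agree when their multiples stay close. *)
Lemma muln_bounded_le0 (d c : R) : (forall k, k.+1%:R * d <= c) -> d <= 0.
Proof.
move=> h; rewrite leNgt; apply/negP => d0.
have := h (Num.bound `|c / d|).
have := archi_boundP (normr_ge0 (c / d)); rewrite -ler_pdivlMr// -natr1.
by have := ler_norm (c / d); lra.
Qed.

Lemma floor_sum (M s t : R) (i j : nat) :
  i%:R <= M * s -> M * s < i.+1%:R -> j%:R <= M * t -> M * t < j.+1%:R ->
  (i + j)%:R <= M * (s + t) /\ M * (s + t) <= (i + j)%:R + 2.
Proof.
rewrite -[i.+1%:R]natr1 -[j.+1%:R]natr1 natrD mulrDr => ? ? ? ?.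
by split; lra.
Qed.

Lemma sandwich (j u v : R) : j <= u -> v <= j + 2 -> v - u <= 2.
Proof. by move=> ? ?; lra. Qed.

(** A monotone multiplicative function of [n] is a power of [n]: compare the
    powers of [n] with those of 2. *)
Lemma onesF_powR c n : onesF 2 = 2 `^ c -> 0 <= c -> (0 < n)%N -> onesF n = n%:R `^ c.
Proof.
move=> l2 c0 n0.
have ln2 : 0 < ln (2 : R) by rewrite ln_gt0// ltr1n.
have l_gt0 k : (0 < k)%N -> 0 < onesF k.
  by case: k => // k _; apply: lt_le_trans (onesF_ge1 k).
have lnl2 : ln (onesF 2) = c * ln 2 by rewrite l2 ln_powR.
have npos : (0 : R) < n%:R by rewrite ltr0n.
have key k : exists j : nat,
   [/\ j%:R * ln 2 <= k%:R * ln (n%:R : R), k%:R * ln (n%:R : R) <= j.+1%:R * ln 2,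
       j%:R * (c * ln 2) <= k%:R * ln (onesF n) &
       k%:R * ln (onesF n) <= j.+1%:R * (c * ln 2)].
  have nk0 : (0 < n ^ k)%N by rewrite expn_gt0 n0.
  have /andP[h1 h2] := trunc_log_bounds (isT : (1 < 2)%N) nk0.
  set j := trunc_log 2 _ in h1 h2; exists j.
  rewrite -lnl2 -!(mulrC (ln _)) !mulr_natr -!lnXn ?l_gt0//.
  rewrite -!onesFX -!natrX !ler_ln ?posrE ?l_gt0 ?ltr0n ?expn_gt0 ?n0//.
  by rewrite !ler_nat !onesF_le ?h1 ?(ltnW h2) ?expn_gt0 ?n0.
have lnE : ln (onesF n) = c * ln n%:R.
  have cl0 : 0 <= c * ln 2 by rewrite mulr_ge0// ltW.
  apply: le_anti; rewrite -[X in X && _]subr_le0 -[X in _ && X]subr_le0; apply/andP; split.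
    apply: (@muln_bounded_le0 _ (c * ln 2)) => k; have [j [h1 h2 h3 h4]] := key k.+1.
    have := ler_wpM2l c0 h1; rewrite mulrBr -natr1 in h4 *.
    by move: h4; lra.
  apply: (@muln_bounded_le0 _ (c * ln 2)) => k; have [j [h1 h2 h3 h4]] := key k.+1.
  have := ler_wpM2l c0 h2; rewrite mulrBr -natr1.
  by move: h3; lra.
by rewrite -[LHS]lnK ?posrE ?l_gt0// lnE -ln_powR lnK// posrE powR_gt0.
Qed.

(** If [F 1 1 = 1], then [F] is the maximum.  Otherwise [F 1 1 = 2 `^ c] with
    [0 < c <= 1], and [F] is the l_p norm for [p = c^-1]: it is so at
    proportional integer powers, and by monotonicity everywhere. *)
Lemma associative_norm_lp : exists p, (1 <= p)%E /\
  forall a b, 0 <= a -> 0 <= b -> F a b = lp2 p a b.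
Proof.
have l2 : onesF 2 = F 1 1 by rewrite /= Fs0.
have := onesF_ge1 1; rewrite le_eqVlt => /orP[/eqP l21|l21].
  exists +oo%E; split=> [|a b a0 b0]; first by rewrite leey.
  rewrite /= !ger0_norm//.
  have m0 : 0 <= Num.max a b by rewrite le_max a0.
  apply/eqP; rewrite eq_le; apply/andP; split.
    apply: le_trans (_ : F (Num.max a b * 1) (Num.max a b * 1) <= _).
      by rewrite !mulr1 F_le// le_max lexx ?orbT.
    by rewrite FZ// -l2 -l21 mulr1.
  by rewrite ge_max -{1}(Fs0 a0) -{2}(F0s b0) !F_le.
have ln2 : 0 < ln (2 : R) by rewrite ln_gt0// ltr1n.
pose c := ln (onesF 2) / ln 2.
have c0 : 0 < c by rewrite divr_gt0// ln_gt0.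
have c1 : c <= 1.
  by rewrite ler_pdivrMr// mul1r l2 ler_ln ?posrE// -l2 (lt_trans _ l21).
have l2c : onesF 2 = 2 `^ c.
  rewrite -[LHS]lnK ?posrE ?(lt_trans _ l21)// -[RHS]lnK ?posrE ?powR_gt0//.
  by rewrite ln_powR /c divfK ?gt_eqF.
have onesFE n : onesF n = n%:R `^ c.
  case: n => [|n]; first by rewrite powR0 ?gt_eqF.
  by apply: onesF_powR => //; exact: ltW.
have cV : c^-1^-1 = c by rewrite invrK.
exists (c^-1)%:E; split=> [|a b a0 b0]; first by rewrite lee_fin invf_ge1.
rewrite /= cV !ger0_norm//.
have cn0 : c != 0 by rewrite gt_eqF.
set s := a `^ c^-1; set t := b `^ c^-1.
have s0 : 0 <= s by exact: powR_ge0.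
have t0 : 0 <= t by exact: powR_ge0.
have aE : a = s `^ c by rewrite /s -{2}cV powRK ?invr_eq0.
have bE : b = t `^ c by rewrite /t -{2}cV powRK ?invr_eq0.
pose V := F a b `^ c^-1.
have F0 : 0 <= F a b by apply: le_trans (F_le (lexx 0) a0 (lexx 0) b0); rewrite Fs0.
suff VE : V = s + t by rewrite -VE /V -{2}cV powRK ?invr_eq0.
have V0 : 0 <= V by exact: powR_ge0.
(* (s + t) and V lie in a common interval of length 2 / k.+1 *)
have key k : exists j : nat, [/\ j%:R <= k.+1%:R * (s + t), k.+1%:R * (s + t) <= j%:R + 2,
    j%:R <= k.+1%:R * V & k.+1%:R * V <= j%:R + 2].
  have M0 : (0 : R) < k.+1%:R by rewrite ltr0n.
  set M : R := k.+1%:R in M0 *.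
  have /andP[i1 i2] := truncn_itv (mulr_ge0 (ltW M0) s0).
  have /andP[j1 j2] := truncn_itv (mulr_ge0 (ltW M0) t0).
  set i := Num.truncn _ in i1 i2; set j := Num.truncn _ in j1 j2.
  have MF : F (M `^ c * a) (M `^ c * b) = M `^ c * F a b by rewrite FZ// powR_ge0.
  have MV : M * V = F (M `^ c * a) (M `^ c * b) `^ c^-1.
    by rewrite MF powRM ?powR_ge0// powRK ?(ltW M0).
  have cge : 0 <= c^-1 by rewrite invr_ge0 ltW.
  have natK n : onesF n `^ c^-1 = n%:R by rewrite onesFE powRK.
  have le1 u v : 0 <= u -> u <= v -> u `^ c <= v `^ c.
    by move=> u0 uv; rewrite ge0_ler_powR ?nnegrE ?(ltW c0)// (le_trans u0).
  have le2 u v : 0 <= u -> u <= v -> u `^ c^-1 <= v `^ c^-1.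
    by move=> u0 uv; rewrite ge0_ler_powR ?nnegrE// (le_trans u0).
  have [st1 st2] := floor_sum i1 i2 j1 j2.
  have Mge : 0 <= M by exact: ltW.
  have Ma : M `^ c * a = (M * s) `^ c by rewrite aE powRM.
  have Mb : M `^ c * b = (M * t) `^ c by rewrite bE powRM.
  have lo : onesF (i + j) <= F (M `^ c * a) (M `^ c * b).
    by rewrite onesFD F_le ?onesF_ge0// onesFE ?Ma ?Mb le1.
  have up : F (M `^ c * a) (M `^ c * b) <= onesF (i.+1 + j.+1).
    rewrite onesFD F_le ?mulr_ge0 ?powR_ge0// onesFE ?Ma ?Mb le1 ?mulr_ge0//; exact: ltW.
  have F0' : 0 <= F (M `^ c * a) (M `^ c * b) by apply: le_trans lo; exact: onesF_ge0.
  exists (i + j)%N; split => //; rewrite MV.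
    by apply: le_trans (le2 _ _ (onesF_ge0 _) lo); rewrite natK.
  apply: le_trans (le2 _ _ F0' up) _.
  by rewrite natK addSn addnS -addn2 natrD.
apply: le_anti; rewrite -[X in X && _]subr_le0 -[X in _ && X]subr_le0; apply/andP; split.
  apply: (@muln_bounded_le0 _ 2) => k; have [j [h1 h2 h3 h4]] := key k.
  by rewrite mulrBr; apply: sandwich h1 h4.
apply: (@muln_bounded_le0 _ 2) => k; have [j [h1 h2 h3 h4]] := key k.
by rewrite mulrBr; apply: sandwich h3 h2.
Qed.

End AssociativeNorm.

(** * Limits along pairs of blocks *)
Section PairLimits.
Context {R : realType} {X : completeNormedModType R}.
Variables (x : nat -> X) (hx : schauder_basis x).
Implicit Types (u v w : X).

(** For every [C > 1], successive vectors [u] and [v] far enough along the basis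
    satisfy the two-term l_p estimate with constant [C]. *)
Definition pairs_lp (p : \bar R) : Prop := forall C : R, 1 < C -> exists N,
  forall u v m q, inspan x N m u -> inspan x m q v ->
    within C `|u + v| (lp2 p `|u| `|v|).

(** [(u, v)] is a normalized block sequence of length 2 supported beyond [N]. *)
Definition block_pair N u v : Prop :=
  exists m q, [/\ inspan x N m u, inspan x m q v, `|u| = 1 & `|v| = 1].

Lemma block_pair_le N N' u v : (N <= N')%N -> block_pair N' u v -> block_pair N u v.
Proof.
move=> NN [m [q [h1 h2 h3 h4]]]; exists m, q; split => //.
exact: inspan_sub NN (leqnn m) h1.
Qed.

Lemma block_pair_nbasis N i j : (N <= i)%N -> (i < j)%N ->
  block_pair N (nbasis x i) (nbasis x j).
Proof.
move=> Ni ij; exists i.+1, j.+1; split; rewrite ?nbasis_norm//.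
  exact: inspan_sub Ni (leqnn _) (inspan_nbasis hx _).
exact: inspan_sub ij (leqnn _) (inspan_nbasis hx _).
Qed.

Lemma inspan_lt m q v : inspan x m q v -> v != 0 -> (m < q)%N.
Proof.
move=> h v0; rewrite ltnNge; apply: contra v0 => qm; apply/eqP.
by rewrite (inspan_proj hx h) /proj big_geq.
Qed.

Lemma block_seq_nat (y : nat -> X) (b : nat -> nat) :
  (forall k, y k != 0) -> (forall k, inspan x (b k) (b k.+1) (y k)) -> block_seq x y.
Proof.
move=> y0 hb; apply: (@block_seqI _ _ _ _ _ _ b (fun k => b k.+1)) => // i j ij.
have b_le : {homo b : k l / (k <= l)%N}.
  apply: homo_leq => // [k l n|k]; first exact: leq_trans.
  by apply/ltnW/(inspan_lt (hb k) (y0 k)).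
exact: b_le.
Qed.

Lemma good_pairs (y : nat -> X) : good y -> forall a b : R, exists L : R,
  forall e, 0 < e -> exists K, forall k l, (K <= k)%N -> (k < l)%N ->
    `| `|a *: y k + b *: y l| - L| < e.
Proof.
move=> gy a b.
have [L hL] := gy 2 (fun i => if i == ord0 then a else b).
exists L => e /hL [K hK]; exists K => k l Kk kl.
have := hK (fun i => if i == ord0 then k else l).
rewrite big_ord_recl big_ord1/=; apply.
  move=> i j; case: (unliftP ord0 i) => [i'|] ->; case: (unliftP ord0 j) => [j'|] -> //=.
  by rewrite !ord1.
by move=> i; case: eqP => // _; rewrite (leq_trans Kk)// ltnW.
Qed.

(** If all normalized block sequences are good, then the norm of [a *: u + b *: v]
    has a limit along all block pairs [(u, v)] moving to infinity, with [a] and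
    [b] fixed.  Otherwise there are arbitrarily far pairs whose value stays away
    from the limit taken along the normalized basis; chaining such pairs with
    normalized basis vectors in between gives a block sequence that is not
    good. *)
Lemma pair_limit :
  (forall y : nat -> X, block_seq x y -> normalized y -> good y) ->
  exists F : R -> R -> R, forall a b e, 0 < e -> exists N, forall u v, block_pair N u v ->
    `| `|a *: u + b *: v| - F a b| < e.
Proof.
move=> hg.
have ge : good (nbasis x).
  apply: hg => [|k]; last exact: nbasis_norm.
  apply: (@block_seq_nat _ id) => k; last exact: inspan_nbasis.
  by apply: norm1_neq0; apply: nbasis_norm.
have /choice [F0 FP] := fun ab : R * R => good_pairs ge ab.1 ab.2.
exists (fun a b => F0 (a, b)) => a b e e0; apply: contrapT => hn.
(* G N is a bad pair beyond N, together with bounds of its supports *)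
have /choice [G GP] : forall N, exists g : (X * X) * (nat * nat),
    [/\ [/\ inspan x N g.2.1 g.1.1, inspan x g.2.1 g.2.2 g.1.2, `|g.1.1| = 1 &
        `|g.1.2| = 1] & e <= `| `|a *: g.1.1 + b *: g.1.2| - F0 (a, b)|].
  move=> N; apply: contrapT => hN; apply: hn; exists N => u v [m [q h]].
  by rewrite ltNge; apply/negP => he; apply: hN; exists ((u, v), (m, q)).
(* stage j of the chain starts at P j, and its basis vector is that of
   index E (P j) *)
pose E N := maxn N (G N).2.2.
pose P := fix P j := if j is j'.+1 then (E (P j')).+1 else 0%N.
have P_ge j : (j <= P j)%N.
  by elim: j => // j ih; rewrite /= ltnS (leq_trans ih) ?leq_maxl.
pose z k : X := let j := P (k %/ 3)%N in
  match (k %% 3)%N with 0 => (G j).1.1 | 1 => (G j).1.2 | _ => nbasis x (E j) end.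
(* z k is supported in [bt k, bt k.+1) *)
pose bt k : nat := let j := P (k %/ 3)%N in
  match (k %% 3)%N with 0 => j | 1 => (G j).2.1 | _ => E j end.
have div3 j r : (r < 3)%N -> ((j * 3 + r) %/ 3 = j)%N /\ ((j * 3 + r) %% 3 = r)%N.
  by move=> r3; rewrite divnMDl// modnMDl modn_small// divn_small// addn0.
have z0 j : z (j * 3 + 0)%N = (G (P j)).1.1 by rewrite /z; have [-> ->] := div3 j 0 isT.
have z1 j : z (j * 3 + 1)%N = (G (P j)).1.2 by rewrite /z; have [-> ->] := div3 j 1%N isT.
have z2 j : z (j * 3 + 2)%N = nbasis x (E (P j)) by rewrite /z; have [-> ->] := div3 j 2%N isT.
have b0 j : bt (j * 3 + 0)%N = P j by rewrite /bt; have [-> ->] := div3 j 0 isT.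
have b1 j : bt (j * 3 + 1)%N = (G (P j)).2.1 by rewrite /bt; have [-> ->] := div3 j 1%N isT.
have b2 j : bt (j * 3 + 2)%N = E (P j) by rewrite /bt; have [-> ->] := div3 j 2%N isT.
have zb k : inspan x (bt k) (bt k.+1) (z k) /\ `|z k| = 1.
  rewrite (divn_eq k 3); set j := (k %/ 3)%N.
  have : (k %% 3 < 3)%N by rewrite ltn_mod.
  have [[g1 g2 g3 g4] _] := GP (P j).
  case: (k %% 3)%N => [|[|[|//]]] _; rewrite -addnS ?z0 ?z1 ?z2 ?b0 ?b1 ?b2; split=> //.
  - exact: inspan_sub (leqnn _) (leq_maxr _ _) g2.
  - rewrite (_ : bt _ = P j.+1); first exact: inspan_nbasis.
    by rewrite -b0; congr bt; rewrite mulSn; lia.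
  - exact: nbasis_norm.
have gz : good z.
  apply: hg => [|k]; last by have [] := zb k.
  apply: (@block_seq_nat _ bt) => k; have [] := zb k => // _ h.
  exact: norm1_neq0.
have [L hL] := good_pairs gz a b.
have e3 : 0 < e / 3 by rewrite divr_gt0.
have [K1 hK1] := hL _ e3; have [K2 hK2] := FP (a, b) _ e3.
pose j := maxn K1 K2.
have jK1 : (K1 <= j)%N by exact: leq_maxl.
have jK2 : (K2 <= j)%N by exact: leq_maxr.
have h1 := hK1 (j * 3 + 0)%N (j * 3 + 1)%N ltac:(lia) ltac:(lia).
have h2 := hK1 (j * 3 + 2)%N (j.+1 * 3 + 2)%N ltac:(lia) ltac:(lia).
have EP : (K2 <= E (P j))%N.
  by rewrite (leq_trans jK2)// (leq_trans (P_ge j))// leq_maxl.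
have EE : (E (P j) < E (P j.+1))%N.
  by apply: leq_trans (leq_maxl _ _); rewrite /= ltnS.
have h3 := hK2 _ _ EP EE; have [_ h4] := GP (P j).
move: h1 h2 h3 h4; rewrite z0 z1 !z2 /=.
set A := `|_ + _|; set B := `|_ + _|; set f := F0 _ => h1 h2 h3; apply/negP; rewrite -ltNge.
move: h1 h2 h3; rewrite !ltr_norml => /andP[? ?] /andP[? ?] /andP[? ?].
by apply/andP; split; lra.
Qed.

End PairLimits.

(** * The limit norm is an l_p norm *)
Section PairNorm.
Context {R : realType} {X : completeNormedModType R}.
Variables (x : nat -> X) (hx : schauder_basis x).
Variable F : R -> R -> R.
(** [F a b] is the limit of the norm of [a *: u + b *: v] along block pairs. *)
Hypothesis FP : forall a b e, 0 < e -> exists N, forall u v, block_pair x N u v ->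
    `| `|a *: u + b *: v| - F a b| < e.
Implicit Types (u v w : X) (a b c t : R).

Local Notation nb := (nbasis x).

Lemma pair_cvg (u v : nat -> X) (a_ b_ : nat -> R) a b :
  (forall N, block_pair x N (u N) (v N)) -> a_ @ \oo --> a -> b_ @ \oo --> b ->
  (fun N => `|a_ N *: u N + b_ N *: v N|) @ \oo --> F a b.
Proof.
move=> uv aa bb; apply/cvgrPdist_lt => e e0.
have e3 : 0 < e / 3 by rewrite divr_gt0.
have [K hK] := FP a b e3; near=> N.
have h1 : `| `|a *: u N + b *: v N| - F a b| < e / 3.
  apply: hK; apply: block_pair_le (uv N).
  by near: N; exact: nbhs_infty_ge.
have h2 : `|a - a_ N| < e / 3 by near: N; move/cvgrPdist_lt: aa; apply.
have h3 : `|b - b_ N| < e / 3 by near: N; move/cvgrPdist_lt: bb; apply.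
have [m [q [_ _ u1 v1]]] := uv N.
have h4 : `| `|a *: u N + b *: v N| - `|a_ N *: u N + b_ N *: v N| | <=
    `|a - a_ N| + `|b - b_ N|.
  apply: le_trans (ler_dist_dist _ _) _; rewrite opprD addrACA -!scalerBl.
  by apply: le_trans (ler_normD _ _) _; rewrite !normrZ u1 v1 !mulr1.
move: h1 h4; set A := `|a *: _ + _|; set B := `|a_ _ *: _ + _| => h1 h4.
by apply: le_lt_trans (ler_distD A _ _) _; rewrite [`|_ - A|]distrC; lra.
Unshelve. all: end_near. Qed.

Lemma nb_cvg a b : (fun N => `|a *: nb N + b *: nb N.+1|) @ \oo --> F a b.
Proof.
apply: (@pair_cvg _ _ (cst a) (cst b)); [|exact: cvg_cst|exact: cvg_cst].
by move=> N; apply: block_pair_nbasis.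
Qed.

Arguments nb_cvg : clear implicits.

Lemma pairF_unique a b (l : R) :
  (fun N => `|a *: nb N + b *: nb N.+1|) @ \oo --> l -> F a b = l.
Proof.
move=> h.
exact: (@norm_cvg_unique _ R ((fun N => `|a *: nb N + b *: nb N.+1|) @ \oo) _
  (F a b) l (nb_cvg a b) h).
Qed.

(** [F] inherits the norm axioms; replacing a block by its opposite makes it
    unconditional, whence monotone on the nonnegative reals. *)
Lemma pairFZ t a b : F (t * a) (t * b) = `|t| * F a b.
Proof.
apply: pairF_unique.
rewrite (_ : (fun N => _) = fun N => `|t| * `|a *: nb N + b *: nb N.+1|).
  by apply: cvgMl_tmp; apply: nb_cvg.
by apply/funext => N; rewrite -normrZ scalerDr !scalerA.
Qed.

Lemma pairFNl a b : F (- a) b = F a b.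
Proof.
apply: pairF_unique.
have := @pair_cvg (fun N => - nb N) (fun N => nb N.+1) (cst a) (cst b) a b.
rewrite (_ : (fun N => `|cst a N *: _ + _|) = fun N => `|- a *: nb N + b *: nb N.+1|).
  apply; [|exact: cvg_cst|exact: cvg_cst] => N.
  have [m [q [h1 h2 h3 h4]]] := block_pair_nbasis hx (leqnn N) (ltnSn N).
  by exists m, q; split; rewrite ?normrN// -scaleN1r; exact: inspanZ.
by apply/funext => N; rewrite /cst scalerN scaleNr.
Qed.

Lemma pairFNr a b : F a (- b) = F a b.
Proof.
by rewrite -pairFNl -[- a]mulN1r -[- b]mulN1r pairFZ normrN1 mul1r.
Qed.

Lemma pairFD a b a' b' : F (a + a') (b + b') <= F a b + F a' b'.
Proof.
apply: (ler_cvg_to (nb_cvg (a + a') (b + b')) (cvgD (nb_cvg a b) (nb_cvg a' b'))).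
apply: nearW => N; rewrite fctE.
by rewrite !scalerDl addrACA; apply: ler_normD.
Qed.

Lemma pairFs0 a : F a 0 = `|a|.
Proof.
apply: pairF_unique.
rewrite (_ : (fun N => _) = cst `|a|); first exact: cvg_cst.
by apply/funext => N; rewrite scale0r addr0 normrZ nbasis_norm// mulr1.
Qed.

Lemma pairF0s a : F 0 a = `|a|.
Proof.
apply: pairF_unique.
rewrite (_ : (fun N => _) = cst `|a|); first exact: cvg_cst.
by apply/funext => N; rewrite scale0r add0r normrZ nbasis_norm// mulr1.
Qed.

(** [a] is a convex combination of [a'] and [- a']. *)
Lemma pairF_lel a a' b : 0 <= a -> a <= a' -> F a b <= F a' b.
Proof.
move=> a0 aa; have [a'0|a'0] := eqVneq a' 0.
  by have -> : a = a' by apply: le_anti; rewrite aa a'0 a0.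
have a'p : 0 < a' by rewrite lt_neqAle eq_sym a'0 (le_trans a0).
pose th := (1 + a / a') / 2.
have th0 : 0 <= th by rewrite divr_ge0// addr_ge0// divr_ge0// ltW.
have th1 : 0 <= 1 - th.
  rewrite subr_ge0 ler_pdivrMr// mul1r.
  have : a / a' <= 1 by rewrite ler_pdivrMr// mul1r.
  by lra.
have -> : F a b = F (th * a' + (1 - th) * - a') (th * b + (1 - th) * b).
  congr (F _ _); rewrite /th; field => //.
apply: le_trans (pairFD _ _ _ _) _; rewrite !pairFZ pairFNl !ger0_norm//.
by rewrite -mulrDl addrC subrK mul1r.
Qed.

Lemma pairF_ler a b b' : 0 <= b -> b <= b' -> F a b <= F a b'.
Proof.
move=> a0 aa; have [a'0|a'0] := eqVneq b' 0.
  by have -> : b = b' by apply: le_anti; rewrite aa a'0 a0.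
have a'p : 0 < b' by rewrite lt_neqAle eq_sym a'0 (le_trans a0).
pose th := (1 + b / b') / 2.
have th0 : 0 <= th by rewrite divr_ge0// addr_ge0// divr_ge0// ltW.
have th1 : 0 <= 1 - th.
  rewrite subr_ge0 ler_pdivrMr// mul1r.
  have : b / b' <= 1 by rewrite ler_pdivrMr// mul1r.
  by lra.
have -> : F a b = F (th * a + (1 - th) * a) (th * b' + (1 - th) * - b').
  congr (F _ _); rewrite /th; field => //.
apply: le_trans (pairFD _ _ _ _) _; rewrite !pairFZ pairFNr !ger0_norm//.
by rewrite -mulrDl addrC subrK mul1r.
Qed.

(** Every vector is its norm times a normalized vector with support in the same
    interval; for the null vector a normalized basis vector is taken. *)
Lemma normalize m q v : (m < q)%N -> inspan x m q v ->
  exists w, [/\ inspan x m q w, `|w| = 1 & `|v| *: w = v].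
Proof.
move=> mq hv; have [->|v0] := eqVneq v 0.
  exists (nb m); split; rewrite ?nbasis_norm ?normr0 ?scale0r//.
  exact: inspan_sub (leqnn _) mq (inspan_nbasis hx m).
exists (`|v|^-1 *: v); split.
- exact: inspanZ.
- by rewrite normrZ normfV normr_id mulVf ?normr_eq0.
- by rewrite scalerA divff ?normr_eq0// scale1r.
Qed.

Lemma nb_comb_inspan m k a b : (m <= k)%N ->
  inspan x m k.+2 (a *: nb k + b *: nb k.+1).
Proof.
move=> mk; apply: inspanD => //; apply: inspanZ => //.
  exact: inspan_sub (inspan_nbasis hx _).
by apply: inspan_sub (inspan_nbasis hx _) => //; exact: leqW.
Qed.

(** Both sides are the limit of the norms of combinations of three successive
    normalized basis vectors, in which the last two, respectively the first two,
    are merged into one block. *)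
Lemma pairFA a b c : F a (F b c) = F (F a b) c.
Proof.
pose T N := `|a *: nb N + b *: nb N.+1 + c *: nb N.+2|.
have /choice [w wP] : forall N, exists w, [/\ inspan x N.+1 N.+3 w, `|w| = 1 &
    `|b *: nb N.+1 + c *: nb N.+2| *: w = b *: nb N.+1 + c *: nb N.+2].
  by move=> N; apply: normalize => //; apply: nb_comb_inspan.
have /choice [w' w'P] : forall N, exists w, [/\ inspan x N N.+2 w, `|w| = 1 &
    `|a *: nb N + b *: nb N.+1| *: w = a *: nb N + b *: nb N.+1].
  by move=> N; apply: normalize => //; apply: nb_comb_inspan.
apply: (@norm_cvg_unique _ _ (T @ \oo)).
  rewrite (_ : T = fun N => `|cst a N *: nb N + `|b *: nb N.+1 + c *: nb N.+2| *: w N|).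
    apply: pair_cvg => [N||]; [|exact: cvg_cst|].
      have [h1 h2 _] := wP N; exists N.+1, N.+3; split; rewrite ?nbasis_norm//.
      exact: inspan_nbasis.
    apply: (@pair_cvg (fun N => nb N.+1) (fun N => nb N.+2) (cst b) (cst c)).
    - by move=> N; apply: block_pair_nbasis.
    - exact: cvg_cst.
    - exact: cvg_cst.
  by apply/funext => N; have [_ _ ->] := wP N; rewrite addrA.
rewrite (_ : T = fun N => `| `|a *: nb N + b *: nb N.+1| *: w' N + cst c N *: nb N.+2|).
  apply: pair_cvg => [N||]; [|exact: nb_cvg|exact: cvg_cst].
  have [h1 h2 _] := w'P N; exists N.+2, N.+3; split; rewrite ?nbasis_norm//.
  exact: inspan_nbasis.
by apply/funext => N; have [_ _ ->] := w'P N.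
Qed.

Lemma pairF_lp2 : exists p, (1 <= p)%E /\ forall a b, 0 <= a -> 0 <= b -> F a b = lp2 p a b.
Proof.
apply: associative_norm_lp.
- by move=> t a b t0; rewrite pairFZ ger0_norm.
- exact: pairFA.
- by move=> a a0; rewrite pairFs0 ger0_norm.
- by move=> a a0; rewrite pairF0s ger0_norm.
- move=> a b a' b' a0 aa b0 bb.
  exact: le_trans (pairF_lel _ a0 aa) (pairF_ler _ b0 bb).
- have := pairFD 1 0 0 1; rewrite addr0 add0r pairFs0 pairF0s normr1; exact.
Qed.

(** Pointwise convergence of 1-Lipschitz functions on the unit interval is
    uniform: it suffices to consider the points [i / M]. *)
Lemma uniform_unit (I : Type) (B : nat -> I -> Prop) (f : I -> R -> R) (g : R -> R) :
  (forall N N' i, (N <= N')%N -> B N' i -> B N i) ->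
  (forall N i s t, B N i -> `|f i s - f i t| <= `|s - t|) ->
  (forall s t, `|g s - g t| <= `|s - t|) ->
  (forall t e, 0 < e -> exists N, forall i, B N i -> `|f i t - g t| < e) ->
  forall e, 0 < e -> exists N, forall i t, B N i -> 0 <= t <= 1 -> `|f i t - g t| < e.
Proof.
move=> Ble fL gL h e e0; have e3 : 0 < e / 3 by rewrite divr_gt0.
pose M := (Num.bound (e / 3)^-1).+1.
have M0 : (0 : R) < M%:R by rewrite ltr0n.
have Me : M%:R^-1 < e / 3.
  rewrite invf_plt ?posrE// -[M%:R]natr1; apply: lt_trans (archi_boundP _) _.
    by rewrite invr_ge0 ltW.
  by rewrite ltrDl.
have : \forall N \near \oo, forall j : 'I_M.+1, forall i, B N i ->
    `|f i (j%:R / M%:R) - g (j%:R / M%:R)| < e / 3.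
  apply: filter_forall => j; have [N hN] := h (j%:R / M%:R) _ e3.
  by exists N => // N' /= NN i Bi; apply: hN; apply: Ble Bi.
move=> [N _ hN]; exists N => i t Bi /andP[t0 t1].
have /andP[j1 j2] := truncn_itv (mulr_ge0 t0 (ltW M0)).
set j := Num.truncn _ in j1 j2.
have jM : (j < M.+1)%N.
  by rewrite ltnS -(ler_nat R); apply: le_trans j1 _; rewrite ler_piMl// ltW.
have := hN N (leqnn N) (Ordinal jM) i Bi => /=; set s := j%:R / M%:R => h1.
have st : `|t - s| < e / 3.
  have s1 : s <= t by rewrite ler_pdivrMr.
  rewrite ger0_norm ?subr_ge0//; apply: lt_trans Me.
  rewrite ltrBlDr -[X in X + _]mul1r -mulrDl ltr_pdivlMr//.
  by rewrite addrC natr1.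
have h2 := fL N i t s Bi; have h3 := gL s t; rewrite distrC in h3.
have h3' : `|g s - g t| <= `|t - s| by rewrite distrC.
apply: le_lt_trans (ler_distD (f i s) _ _) _.
apply: le_lt_trans (lerD (lexx _) (ler_distD (g s) _ _)) _.
move: st h1 h2 h3'; clear; set A := `|t - s|; set B' := `|f i s - g s|.
by set C := `|f i t - _|; set D := `|g s - g t|; lra.
Qed.

Lemma pairF_lipr a s t : `|F a s - F a t| <= `|s - t|.
Proof.
have key (u v : R) : F a u - F a v <= `|u - v|.
  by have := pairFD a v 0 (u - v); rewrite addr0 addrC subrK pairF0s; lra.
by rewrite ler_norml key andbT -lerN2 opprK opprB distrC.
Qed.

Lemma pairF_lipl b s t : `|F s b - F t b| <= `|s - t|.
Proof.
have key (u v : R) : F u b - F v b <= `|u - v|.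
  by have := pairFD v b (u - v) 0; rewrite addr0 addrC subrK pairFs0; lra.
by rewrite ler_norml key andbT -lerN2 opprK opprB distrC.
Qed.

Lemma within_close C (s t : R) : 0 < C -> 0 <= t -> `|s - t| <= (1 - C^-1) * t ->
  within C s t.
Proof.
move=> C0 t0; rewrite ler_norml => /andP[h1 h2]; split; first by lra.
have : 2 - C^-1 <= C.
  have : 0 <= (C - 1) ^+ 2 / C by rewrite divr_ge0 ?sqr_ge0// ltW.
  rewrite (_ : _ / C = C - 2 + C^-1); first by lra.
  by field; rewrite gt_eqF.
move=> /(ler_wpM2r t0); lra.
Qed.

(** The convergence is uniform in the scalars: by homogeneity the larger one can
    be taken to be 1. *)
Lemma pairF_uniform C : 1 < C -> exists N, forall u v m q,
  inspan x N m u -> inspan x m q v -> within C `|u + v| (F `|u| `|v|).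
Proof.
move=> C1; have C0 : 0 < C by apply: lt_trans C1.
have d0 : 0 < 1 - C^-1 by rewrite subr_gt0 invf_lt1.
pose B N (uv : X * X) := block_pair x N uv.1 uv.2.
have Ble N N' i : (N <= N')%N -> B N' i -> B N i by exact: block_pair_le.
have [|||N1 h1] := @uniform_unit _ B (fun uv t => `|uv.1 + t *: uv.2|) (F 1) Ble _ _ _ _ d0.
- move=> N [u v] s t [m [q [_ _ _ v1]]] /=; apply: le_trans (ler_dist_dist _ _) _.
  by rewrite opprD addrACA subrr add0r -scalerBl normrZ v1 mulr1.
- by move=> s t; apply: pairF_lipr.
- move=> t e /(FP 1 t) [N hN]; exists N => -[u v] /= /hN.
  by rewrite scale1r.
have [|||N2 h2] := @uniform_unit _ B (fun uv t => `|t *: uv.1 + uv.2|) (F ^~ 1) Ble _ _ _ _ d0.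
- move=> N [u v] s t [m [q [_ _ u1 _]]] /=; apply: le_trans (ler_dist_dist _ _) _.
  by rewrite opprD addrACA subrr addr0 -scalerBl normrZ u1 mulr1.
- by move=> s t; apply: pairF_lipl.
- move=> t e /(FP t 1) [N hN]; exists N => -[u v] /= /hN.
  by rewrite scale1r.
exists (maxn N1 N2) => u v m q hu hv.
have F_ge0 : 0 <= F `|u| `|v|.
  by apply: le_trans (pairF_ler _ (lexx 0) (normr_ge0 v)); rewrite pairFs0 normr_ge0.
apply: within_close => //.
have [u0|u0] := eqVneq u 0.
  by rewrite u0 normr0 add0r pairF0s normr_id subrr normr0 mulr_ge0// ltW.
have [v0|v0] := eqVneq v 0.
  by rewrite v0 normr0 addr0 pairFs0 normr_id subrr normr0 mulr_ge0// ltW.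
have [u' [hu' u'1 uE]] := normalize (inspan_lt hx hu u0) hu.
have [v' [hv' v'1 vE]] := normalize (inspan_lt hx hv v0) hv.
have nu : 0 < `|u| by rewrite normr_gt0.
have nv : 0 < `|v| by rewrite normr_gt0.
have bp : block_pair x (maxn N1 N2) u' v' by exists m, q.
have [vu|/ltW uv] := leP `|v| `|u|.
  have FE : F `|u| `|v| = `|u| * F 1 (`|v| / `|u|).
    by rewrite -[X in X * _]normr_id -pairFZ mulr1 mulrCA divff ?mulr1// gt_eqF.
  have nE : `|u + v| = `|u| * `|u' + (`|v| / `|u|) *: v'|.
    rewrite -[X in X * _]normr_id -normrZ scalerDr scalerA mulrCA divff ?gt_eqF//.
    by rewrite mulr1 uE vE.
  have t01 : 0 <= `|v| / `|u| <= 1.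
    by rewrite divr_ge0//= ler_pdivrMr// mul1r.
  have := h1 (u', v') _ (block_pair_le (leq_maxl _ _) bp) t01 => /= h.
  apply: (@le_trans _ _ ((1 - C^-1) * `|u|)).
    by rewrite nE FE -mulrBr normrM normr_id mulrC ler_pM2r// ltW.
  rewrite ler_pM2l//; apply: le_trans (pairF_ler _ (lexx 0) (normr_ge0 v)).
  by rewrite pairFs0 normr_id.
have FE : F `|u| `|v| = `|v| * F (`|u| / `|v|) 1.
  by rewrite -[X in X * _]normr_id -pairFZ mulr1 mulrCA divff ?mulr1// gt_eqF.
have nE : `|u + v| = `|v| * `|(`|u| / `|v|) *: u' + v'|.
  rewrite -[X in X * _]normr_id -normrZ scalerDr scalerA mulrCA divff ?gt_eqF//.
  by rewrite mulr1 uE vE.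
have t01 : 0 <= `|u| / `|v| <= 1.
  by rewrite divr_ge0//= ler_pdivrMr// mul1r.
have := h2 (u', v') _ (block_pair_le (leq_maxr _ _) bp) t01 => /= h.
apply: (@le_trans _ _ ((1 - C^-1) * `|v|)).
  by rewrite nE FE -mulrBr normrM normr_id mulrC ler_pM2r// ltW.
rewrite ler_pM2l//; apply: le_trans (pairF_lel _ (lexx 0) (normr_ge0 u)).
by rewrite pairF0s normr_id.
Qed.

End PairNorm.

Lemma good_pairs_lp (R : realType) (X : completeNormedModType R) (x : nat -> X) :
  schauder_basis x ->
  (forall y : nat -> X, block_seq x y -> normalized y -> good y) ->
  exists p : \bar R, (1 <= p)%E /\ pairs_lp x p.
Proof.
move=> hx hg; have [F FP] := pair_limit hx hg.
have [p [p1 pE]] := pairF_lp2 hx FP; exists p; split=> // C C1.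
have [N hN] := pairF_uniform hx FP C1; exists N => u v m q hu hv.
by rewrite -pE//; apply: hN hu hv.
Qed.

(** * Pairs, tuples and asymptotic structure *)
Section Tuples.
Context {R : realType} {X : completeNormedModType R}.
Variables (x : nat -> X) (hx : schauder_basis x).
Variable (p : \bar R).
Hypothesis p1 : (1 <= p)%E.
Implicit Types (u v w : X).

Local Notation nb := (nbasis x).

(** The direct form of being stabilized 1-asymptotic l_p: normalized blocks far
    enough along the basis are almost isometric to the unit vectors of l_p^n. *)
Definition tuples_lp : Prop := forall (n : nat) (eps : R), 0 < eps -> exists N,
  forall y : 'I_n -> X, block_seq x y -> normalized y ->
    (forall i l, supp x (y i) l -> (N < l)%N) ->
    equivalent (1 + eps) (comb_norm y) (lp_norm p).

Lemma lp_norm_abs n (a b : 'I_n -> R) : (forall i, `|a i| = `|b i|) ->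
  lp_norm p a = lp_norm p b.
Proof.
move=> ab; case: (p) => [r| |]/=.
  by congr (_ `^ _); apply: eq_bigr => i _; rewrite ab.
all: by apply: eq_bigr => i _; rewrite ab.
Qed.

Lemma lp_norm_ge0 n (a : 'I_n -> R) : 0 <= lp_norm p a.
Proof.
case: (p) => [r| |]/=; rewrite ?powR_ge0//.
all: by elim/big_rec: _ => // i u _ u0; rewrite le_max u0 orbT.
Qed.

Lemma lp_norm_coord n (a : 'I_n -> R) i : `|a i| <= lp_norm p a.
Proof.
case: (p) p1 => [r| |]//= r1; last by apply: (le_bigmax _ (fun i => `|a i|)).
have r0 := lee1_gt0 r1.
rewrite -{1}(@powRK _ r `|a i|) ?gt_eqF// ge0_ler_powR ?nnegrE ?invr_ge0 ?(ltW r0)// ?powR_ge0//.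
  by apply: sumr_ge0 => j _; apply: powR_ge0.
by rewrite (bigD1 i)//= lerDl; apply: sumr_ge0 => j _; apply: powR_ge0.
Qed.

Lemma exists_root_gt1 (n : nat) (eps : R) : 0 < eps -> exists C : R, 1 < C /\ C ^+ n <= 1 + eps.
Proof.
move=> e0; pose C := (1 + eps) `^ (n.+1%:R^-1).
have e1 : 0 <= 1 + eps by rewrite addr_ge0// ltW.
have CE : C ^+ n.+1 = 1 + eps by rewrite -powR_mulrn ?powR_ge0// powRVK.
have C0 : 0 <= C by exact: powR_ge0.
have C1 : 1 < C.
  rewrite ltNge; apply/negP => C1.
  have : C ^+ n.+1 <= 1 by rewrite exprn_ile1.
  by rewrite CE; lra.
by exists C; split=> //; rewrite -CE exprSr ler_peMr ?exprn_ge0// ltW.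
Qed.

(** The estimate for [n] blocks follows by iterating that for pairs, with a
    constant whose [n]-th power is at most [1 + eps]. *)
Lemma pairs_tuples_lp : pairs_lp x p -> tuples_lp.
Proof.
move=> hp n eps e0; have [C [C1 Cn]] := exists_root_gt1 n e0; have [N hN] := hp C C1.
have C0 : 0 < C by apply: lt_trans C1.
exists N => y by_ ny yN a.
have [lo [hi [h1 h2 h3]]] := block_seqE hx by_.
pose z k : X := if insub k is Some i then a i *: y i else 0.
have zE (i : 'I_n) : z i = a i *: y i by rewrite /z valK.
have -> : comb_norm y a = `|\sum_(0 <= k < n) z k|.
  by rewrite big_mkord; congr `|_|; apply: eq_bigr => i _; rewrite zE.
have -> : lp_norm p a = lpn p (fun k => `|z k|) 0 n.
  rewrite -lp_normE; apply: lp_norm_abs => i.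
  by rewrite zE normrZ ny mulr1 normr_id.
apply: (@within_le _ (C ^+ n)) => //; [exact: exprn_gt0|exact: lpn_ge0|].
have -> : C ^+ n = \prod_(0 <= k < n) (cst C k).
  by rewrite prodr_const_nat subn0.
apply: iterate_lp2 => // [k|k /andP[_ kn]]; first exact: ltW.
pose i := Ordinal kn; rewrite -[k]/(nat_of_ord i).
apply: (hN _ _ (hi i) (\sum_(j < n) hi j)%N).
  rewrite zE; apply: inspanZ => //; apply: inspan_sub (h1 i) => //.
  by apply/ltnW/(yN i).
rewrite [X in inspan _ _ _ X]big_seq; apply: inspan_sum => // j.
rewrite mem_index_iota => /andP[ij jn].
rewrite -[j]/(nat_of_ord (Ordinal jn)) zE; apply: inspanZ => //.
apply: inspan_sub (h1 (Ordinal jn)); first by apply: h3; rewrite ltEord.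
by rewrite (bigD1 (Ordinal jn))//= leq_addr.
Qed.

Lemma le_sqr_eps (s t : R) : 0 <= t -> (forall e, 0 < e -> s <= (1 + e) ^+ 2 * t) -> s <= t.
Proof.
move=> t0 h; rewrite leNgt; apply/negP => ts.
have [t00|tp] := eqVneq t 0.
  by have := h 1 ltr01; rewrite t00 mulr0 leNgt -t00 ts.
have {}tp : 0 < t by rewrite lt_neqAle eq_sym tp.
have e0 : 0 < (s / t - 1) / 2 by rewrite divr_gt0// subr_gt0 ltr_pdivlMr// mul1r.
have [C [C1 C2]] := exists_root_gt1 2 e0.
have := h (C - 1); rewrite subr_gt0 addrC subrK => /(_ C1).
rewrite -ler_pdivrMr// => /le_trans/(_ C2).
have : 1 < s / t by rewrite ltr_pdivlMr// mul1r.
lra.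
Qed.

Lemma nb_block n (idx : 'I_n -> nat) :
  (forall i j : 'I_n, (i < j)%N -> (idx i < idx j)%N) ->
  block_seq x (fun i => nb (idx i)) /\ normalized (fun i => nb (idx i)).
Proof.
move=> hi; split; last by move=> i; apply: nbasis_norm.
apply: (@block_seqI _ _ _ _ _ _ idx (fun i => (idx i).+1)).
- by move=> i; apply/norm1_neq0/nbasis_norm.
- by move=> i; apply: inspan_nbasis.
- by move=> i j; rewrite ltEord; apply: hi.
Qed.

Lemma supp_nb k l : supp x (nb k) l -> l = k.
Proof.
move=> /(inspan_supp (inspan_nbasis hx k)) h.
by apply/eqP; rewrite eqn_leq andbC -ltnS.
Qed.

Lemma tuples_lp_nb : tuples_lp -> forall n eps, 0 < eps -> exists y : 'I_n -> X,
  equivalent (1 + eps) (comb_norm y) (lp_norm p).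
Proof.
move=> hS n eps /(hS n) [N hN]; exists (fun i => nb (N.+1 + i)).
have [h1 h2] := @nb_block n (fun i => N.+1 + i)%N (fun i j ij => ltac:(by rewrite ltn_add2l)).
apply: hN => // i l /supp_nb ->; exact: leq_addr.
Qed.

(** The l_p norm is a norm, being approximated by norms of combinations of basis
    vectors. *)
Lemma lp_coord_norm n : tuples_lp -> exists N : coord_norm R n, forall a, N a = lp_norm p a.
Proof.
move=> hS.
have D (a b : 'I_n -> R) : lp_norm p (fun i => a i + b i) <= lp_norm p a + lp_norm p b.
  apply: le_sqr_eps; first by rewrite addr_ge0 ?lp_norm_ge0.
  move=> e e0; have [y hy] := tuples_lp_nb hS n e0.
  have e1 : 0 < 1 + e by rewrite addr_gt0.
  have [h1 _] := hy (fun i => a i + b i); have [_ h2] := hy a; have [_ h3] := hy b.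
  rewrite expr2 -mulrA -ler_pdivrMl//.
  apply: le_trans h1 _; rewrite mulrDr; apply: le_trans (lerD h2 h3).
  rewrite /comb_norm; under eq_bigr do rewrite scalerDl.
  by rewrite big_split/= ler_normD.
have Z t (a : 'I_n -> R) : lp_norm p (fun i => t * a i) = `|t| * lp_norm p a.
  have nE (y : 'I_n -> X) : comb_norm y (fun i => t * a i) = `|t| * comb_norm y a.
    rewrite /comb_norm -normrZ scaler_sumr; congr `|_|.
    by apply: eq_bigr => i _; rewrite scalerA.
  apply: le_anti; apply/andP; split; apply: le_sqr_eps => [|e e0];
    rewrite ?mulr_ge0 ?lp_norm_ge0//.
    have [y hy] := tuples_lp_nb hS n e0; have e1 : 0 < 1 + e by rewrite addr_gt0.
    have [h1 _] := hy (fun i => t * a i); have [_ h2] := hy a.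
    rewrite expr2 -mulrA -ler_pdivrMl//.
    by apply: le_trans h1 _; rewrite nE mulrCA ler_wpM2l.
  have [y hy] := tuples_lp_nb hS n e0; have e1 : 0 < 1 + e by rewrite addr_gt0.
  have [_ h1] := hy (fun i => t * a i); have [h2 _] := hy a.
  rewrite expr2 -mulrA -ler_pdivrMl//.
  by apply: le_trans h1; rewrite nE mulrCA ler_wpM2l.
exists (@CoordNorm R n (lp_norm p) 1 D Z (fun a i => ltac:(by rewrite mul1r; exact: lp_norm_coord))).
by [].
Qed.

(** The player choosing the tails may demand that all vectors lie far out. *)
Lemma game_far (P : seq X -> Prop) n s M : game x P n s ->
  exists s', [/\ size s' = n, P (s ++ s') &
    forall i, (i < n)%N -> tail_span x M (nth 0 s' i) /\ `|nth 0 s' i| = 1].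
Proof.
elim: n s => [|n ih] s /=; first by move=> Ps; exists [::]; rewrite cats0.
move=> /(_ M) [y [My y1 /ih [s' [h1 h2 h3]]]].
exists (y :: s'); split; rewrite /= ?h1//; first by rewrite -cat_rcons.
by case=> [|i]//=; rewrite ltnS; apply: h3.
Qed.

(** The player choosing the vectors may always take normalized basis vectors. *)
Lemma game_nb (P : seq X -> Prop) n s k0 :
  (forall idx, size idx = n -> path ltn k0 idx -> P (s ++ map nb idx)) -> game x P n s.
Proof.
elim: n s k0 => [|n ih] s k0 h /=; first by have := h [::] erefl isT; rewrite cats0.
move=> m; pose k := (maxn m k0).+1; exists (nb k); split.
- apply: inspan_tail_span => //; apply: inspan_sub (inspan_nbasis hx k) => //.
  by rewrite /k leqW// leq_maxl.
- exact: nbasis_norm.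
- apply: (ih _ k) => idx sz pth; rewrite cat_rcons; apply: (h (k :: idx)).
    by rewrite /= sz.
  by rewrite /= pth andbT /k ltnS leq_maxr.
Qed.

Lemma within_refl C (t : R) : 1 <= C -> 0 <= t -> within C t t.
Proof.
move=> C1 t0; have C0 : 0 < C by apply: lt_le_trans C1.
by split; rewrite ?ler_peMl// ler_piMl// invf_le1.
Qed.

Lemma within1 (s t : R) : within 1 s t <-> s = t.
Proof.
rewrite /within invr1 !mul1r; split=> [[h1 h2]|->]//.
by apply: le_anti; rewrite h1 h2.
Qed.

(** Every asymptotic space is isometric to l_p^n, because its basis is
    approximated by blocks that are arbitrarily far; conversely l_p^n is an
    asymptotic space, because it is approximated by basis vectors. *)
Lemma tuples_stabilized : tuples_lp -> stabilized_asymptotic_lp x 1 p.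
Proof.
move=> hS; split=> [n E e [fe he] a|n eps e0].
  apply/within1.
  have key eps : 0 < eps -> exists y : 'I_n -> X,
      within (1 + eps) (comb_norm y a) (lp_norm p a) /\
      within (1 + eps) (comb_norm y a) (comb_norm e a).
    move=> e0; have [N hN] := hS n eps e0.
    have [s [sz [h1 h2] h3]] := game_far N.+1 (he _ e0).
    exists (fun i : 'I_n => nth 0 s i); split; last exact: h2.
    apply: hN => // [i|i l sl]; first exact: (h3 i (ltn_ord i)).2.
    rewrite ltnNge; apply/negP => lN; move/eqP: sl; apply.
    by apply: (tail_span_coord hx (h3 i (ltn_ord i)).1).
  apply: le_anti; apply/andP; split; apply: le_sqr_eps => [|eps e0];
    rewrite ?lp_norm_ge0 ?normr_ge0//.
    have [y [[h1 h2] [h3 h4]]] := key _ e0; have e1 : 0 < 1 + eps by rewrite addr_gt0.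
    rewrite expr2 -mulrA -ler_pdivrMl//.
    exact: le_trans h3 h2.
  have [y [[h1 h2] [h3 h4]]] := key _ e0; have e1 : 0 < 1 + eps by rewrite addr_gt0.
  rewrite expr2 -mulrA -ler_pdivrMl//.
  exact: le_trans h1 h4.
have [N hN] := hS n eps e0; exists N => y by_ ny yN.
have [M ME] := lp_coord_norm n hS.
have eM : comb_norm (ncbasis M) = lp_norm p.
  by apply/funext => a; rewrite comb_norm_ncbasis ME.
exists (normed_coord M), (ncbasis M); split; last by rewrite eM; apply: hN.
split=> [|d d0]; first exact: ncbasisP.
have [N' hN'] := hS n d d0.
apply: (@game_nb _ _ _ N') => idx sz pth; rewrite cat0s.
pose id i := nth 0%N idx i.
have id_lt i j : (i < j)%N -> (j < n)%N -> (id i < id j)%N.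
  move=> ij jn; apply: (@sorted_ltn_nth _ ltn ltn_trans) => //.
  - exact: path_sorted pth.
  - by rewrite inE sz (ltn_trans ij).
  - by rewrite inE sz.
have yE : (fun i : 'I_n => nth 0 (map nb idx) i) = (fun i : 'I_n => nb (id i)).
  by apply/funext => i; rewrite (nth_map 0%N) ?sz.
have [h1 h2] := @nb_block n (fun i => id i) (fun i j ij => id_lt i j ij (ltn_ord j)).
rewrite /= yE eM; split=> //; apply: hN' => // i l /supp_nb ->.
have /allP := order_path_min ltn_trans pth; apply.
by rewrite mem_nth// sz.
Qed.

Lemma stabilized_tuples : stabilized_asymptotic_lp x 1 p -> tuples_lp.
Proof.
move=> [h1 h2] n eps /(h2 n) [N hN]; exists N => y by_ ny yN.
have [E [e [ase eqe]]] := hN y by_ ny yN.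
move=> a; have /within1 <- := h1 n E e ase a; exact: eqe.
Qed.

Lemma tuples_pairs_lp : tuples_lp -> pairs_lp x p.
Proof.
move=> hS C C1; have e0 : 0 < C - 1 by rewrite subr_gt0.
have [N hN] := hS 2 _ e0; rewrite addrC subrK in hN.
exists N.+1 => u v m q hu hv.
have [->|u0] := eqVneq u 0.
  by rewrite normr0 add0r lp20s// normr_id; apply: within_refl => //; exact: ltW.
have [->|v0] := eqVneq v 0.
  by rewrite normr0 addr0 lp2s0// normr_id; apply: within_refl => //; exact: ltW.
have [u' [hu' u'1 uE]] := normalize hx (inspan_lt hx hu u0) hu.
have [v' [hv' v'1 vE]] := normalize hx (inspan_lt hx hv v0) hv.
pose y (i : 'I_2) := if i == 0%N :> nat then u' else v'.
pose a (k : nat) : R := if k == 0%N then `|u| else `|v|.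
have ny : normalized y by move=> i; rewrite /y; case: ifP.
have yin i : inspan x N.+1 q (y i).
  rewrite /y; case: ifP => _.
    by apply: inspan_sub hu' => //; apply/ltnW/(inspan_lt hx hv v0).
  by apply: inspan_sub hv' => //; apply/ltnW/(inspan_lt hx hu u0).
have := hN y _ ny _ (fun i => a i); rewrite lp_normE lpn_rec// lpn_rec// lpn_nil//.
rewrite lp2s0// /comb_norm big_ord_recl big_ord1 /= /y/= /a/= uE vE normr_id; apply.
  apply: (@block_seqI _ _ _ _ _ _ (fun i : 'I_2 => if i == 0%N :> nat then N.+1 else m)
                                   (fun i : 'I_2 => if i == 0%N :> nat then m else q)).
  - by move=> i; apply/norm1_neq0/ny.
  - by move=> i; rewrite /y; case: ifP.
  - by move=> [[|[|//]] ?] [[|[|//]] ?]; rewrite ltEord.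
by move=> i l /(inspan_supp (yin i)) /andP[].
Qed.

Lemma tuples_good : tuples_lp ->
  forall y : nat -> X, block_seq x y -> normalized y -> good y.
Proof.
move=> hS y by_ ny n a; exists (lp_norm p a) => eps e0.
have L0 : 0 < lp_norm p a + 1 by rewrite ltr_wpDl// lp_norm_ge0.
pose d := eps / (lp_norm p a + 1).
have d0 : 0 < d by rewrite divr_gt0.
have [N hN] := hS n d d0; exists N.+1 => k kij kN.
have [lo [hi [h1 h2 h3]]] := block_seqE hx by_.
have lo_ge i : (i <= lo i)%N.
  elim: i => // i ih; apply: leq_ltn_trans ih _.
  have /andP[_ h] := inspan_supp (h1 i) (h2 i).
  by apply: leq_trans h _; apply: h3; rewrite ltEnat/=.
have [||h4 h5] := hN (fun i => y (k i)) _ (fun i => ny (k i)) _ a.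
- split=> [i|i j ij]; first exact: by_.1.
  by apply: by_.2; move: ij; rewrite ltEord ltEnat; apply: kij.
- move=> i l /(inspan_supp (h1 (k i)))/andP[h _].
  by apply: leq_trans (kN i) (leq_trans (lo_ge _) h).
have L0' := lp_norm_ge0 a.
have hd : d * lp_norm p a < eps.
  by rewrite /d mulrAC ltr_pdivrMr// ltr_pM2l// ltrDl.
have hi' : 1 - d <= (1 + d)^-1.
  rewrite -[(1 + d)^-1]mul1r ler_pdivlMr ?addr_gt0//.
  by have := sqr_ge0 d; rewrite expr2; lra.
have h6 := ler_wpM2r L0' hi'.
by rewrite ltr_norml; apply/andP; split; rewrite /comb_norm in h4 h5; lra.
Qed.

End Tuples.

(** * Norms for the counting measure *)
Section CountingLnorm.
Context {R : realType}.
Implicit Types (p : \bar R) (a : nat -> R).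

(** The only negligible set of the counting measure is empty. *)
Lemma counting_ae (P : nat -> Prop) :
  (\forall k \ae (@counting nat R), P k) -> forall k, P k.
Proof.
move=> [B [mB B0 PB]] k; apply: contrapT => nP.
have Bk : B k by exact: PB.
move: B0; rewrite /= /counting; case: ifPn => [/asboolP fB|_]//.
move=> /eqP; rewrite eqe pnatr_eq0 finmap.cardfs_eq0 => /eqP h.
by move: Bk; rewrite -(fset_setK fB) h.
Qed.

Lemma counting_setT_gt0 : (0 < @counting nat R setT)%E.
Proof. by rewrite /counting asboolF//; exact: infinite_nat. Qed.

Lemma Lnorm_countingyE a : Lnorm counting +oo%E (EFin \o a) =
  ess_sup counting (abse \o (EFin \o a)).
Proof. by rewrite unlock counting_setT_gt0. Qed.

Lemma Lnorm_countingE (r : R) a : 0 < r -> Lnorm counting r%:E (EFin \o a) =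
  poweR (\sum_(0 <= k <oo) (`|a k| `^ r)%:E)%E r^-1.
Proof. by move=> r0; rewrite Lnorm_counting. Qed.

Lemma lpn_le_Lnorm p a n : (1 <= p)%E ->
  ((lpn p a 0 n)%:E <= Lnorm counting p (EFin \o a))%E.
Proof.
case: p => [r| |] r1; last by [].
  have r0 := lee1_gt0 r1.
  have h0 k : (0 <= (`|a k| `^ r)%:E)%E by rewrite lee_fin powR_ge0.
  rewrite Lnorm_countingE// /lpn -poweR_EFin; apply: gt0_ler_poweR.
  - by rewrite invr_ge0 ltW.
  - by rewrite in_itv/= leey andbT lee_fin; apply: sumr_ge0 => k _; exact: powR_ge0.
  - by rewrite in_itv/= leey andbT; apply: nneseries_ge0 => k _ _; exact: h0.
  - by rewrite -sumEFin; apply: nneseries_lim_ge => k _ _; exact: h0.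
have h k : (`|a k|%:E <= Lnorm counting +oo%E (EFin \o a))%E.
  rewrite Lnorm_countingyE; move: k; apply: counting_ae.
  exact: (@ess_sup_ge _ _ _ counting (abse \o (EFin \o a))).
rewrite /lpn big_seq; elim/big_rec: _ => [|k u _ ih]; first exact: Lnorm_ge0.
by rewrite EFin_max ge_max h ih.
Qed.

Lemma Lnorm_le_lpn p a (M : R) : (1 <= p)%E -> (forall n, lpn p a 0 n <= M) ->
  (Lnorm counting p (EFin \o a) <= M%:E)%E.
Proof.
case: p => [r| |] r1 h; last by [].
  have r0 := lee1_gt0 r1.
  have M0 : 0 <= M by apply: le_trans (h 0); exact: lpn_ge0.
  have h0 k : (0 <= (`|a k| `^ r)%:E)%E by rewrite lee_fin powR_ge0.
  rewrite Lnorm_countingE// -[M in leRHS](@powRK _ r)// ?gt_eqF// -poweR_EFin.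
  apply: gt0_ler_poweR.
  - by rewrite invr_ge0 ltW.
  - by rewrite in_itv/= leey andbT; apply: nneseries_ge0 => k _ _; exact: h0.
  - by rewrite in_itv/= leey andbT lee_fin powR_ge0.
  apply: lime_le; first by apply: is_cvg_nneseries => k _ _; exact: h0.
  apply: nearW => n; rewrite sumEFin lee_fin.
  rewrite -[leLHS](@powRVK _ r) ?gt_eqF//; last first.
    by apply: sumr_ge0 => k _; exact: powR_ge0.
  have := h n; rewrite /lpn => hn.
  by rewrite ge0_ler_powR ?nnegrE ?powR_ge0// ltW.
rewrite Lnorm_countingyE; apply/ess_supP; apply: nearW => k /=.
rewrite lee_fin; apply: le_trans (h k.+1); rewrite /lpn.
by rewrite big_mkord; exact: (le_bigmax _ (fun i : 'I_k.+1 => `|a i|) ord_max).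
Qed.

(** The tails of an element of l_p, or of c_0 for [p = +oo], tend to 0. *)
Lemma lpn_tail p a : (1 <= p)%E -> (Lnorm counting p (EFin \o a) < +oo)%E ->
  (p = +oo%E -> a @ \oo --> (0 : R)) ->
  forall e, 0 < e -> exists m, forall n, lpn p a m n <= e.
Proof.
case: p => [r| |] r1 fin a0 e e0; last by [].
  have r0 := lee1_gt0 r1.
  pose s n := \sum_(0 <= k < n) `|a k| `^ r.
  have s_le m n : (m <= n)%N -> s m <= s n.
    move=> mn; rewrite /s [leRHS](big_cat_nat (n := m))//= lerDl.
    by apply: sumr_ge0 => k _; exact: powR_ge0.
  pose M := fine (Lnorm counting r%:E (EFin \o a)).
  have ub n : s n <= M `^ r.
    have : lpn r%:E a 0 n <= M.
      rewrite -lee_fin fineK; first exact: lpn_le_Lnorm.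
      by rewrite ge0_fin_numE ?Lnorm_ge0.
    move=> h; rewrite -[leLHS](@powRVK _ r) ?gt_eqF//; last first.
      by apply: sumr_ge0 => k _; exact: powR_ge0.
    by rewrite ge0_ler_powR ?nnegrE ?powR_ge0 ?(ltW r0)// (le_trans _ h)// powR_ge0.
  have scvg : cvg (s @ \oo).
    apply: nondecreasing_is_cvgn; first by move=> m n; exact: s_le.
    by exists (M `^ r) => _ [n _ <-].
  have er : 0 < e `^ r by rewrite powR_gt0.
  have /cvgrPdist_lt/(_ _ er)[m _ hm] := scvg; exists m => n.
  have [nm|mn] := leqP n m; first by rewrite lpn_nil// ltW.
  rewrite /lpn -[e in leRHS](@powRK _ r) ?gt_eqF// ?(ltW e0)//.
  rewrite ge0_ler_powR ?nnegrE ?invr_ge0 ?(ltW r0)// ?powR_ge0//.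
    by apply: sumr_ge0 => k _; exact: powR_ge0.
  have -> : \sum_(m <= k < n) `|a k| `^ r = s n - s m.
    by rewrite /s [X in X - _](big_cat_nat (n := m))//= ?(ltnW mn)// addrAC subrr add0r.
  have /= := hm m (leqnn m).
  have : s n <= lim (s @ \oo) by apply: nondecreasing_cvgn_le => // i j; exact: s_le.
  by rewrite ltr_norml => h1 /andP[_ h2]; lra.
have /cvgrPdist_lt/(_ _ e0)[m _ hm] := a0 erefl; exists m => n.
rewrite /lpn big_seq; elim/big_rec: _ => [|k u]; first exact: ltW.
rewrite mem_index_iota => /andP[mk _] ih; rewrite ge_max ih andbT.
by have /= := hm k mk; rewrite sub0r normrN => /ltW.
Qed.

End CountingLnorm.

(** * Decomposition into finite-dimensional spaces *)
Lemma linear_bundle (R : realType) (U V : lmodType R) (f : U -> V) :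
  linear f -> exists T : {linear U -> V}, forall u, T u = f u.
Proof.
move=> hf; exists (HB.pack_for {linear U -> V} f (GRing.isLinear.Build R U V *:%R f hf)).
by [].
Qed.

Section Decomposition.
Context {R : realType} {X : completeNormedModType R}.
Variables (x : nat -> X) (hx : schauder_basis x).
Variable (p : \bar R).
Hypothesis p1 : (1 <= p)%E.
Implicit Types (u v w : X).

(** Constants greater than 1 all of whose partial products are at most 2, obtained
    as the ratios of consecutive terms of [2 - k.+1^-1]. *)
Lemma bounded_products : exists C : nat -> R, (forall k, 1 < C k) /\
  forall m n, \prod_(m <= k < n) C k <= 2.
Proof.
pose a k : R := 2 - k.+1%:R^-1.
have kV k : 0 < (k.+1%:R^-1 : R) <= 1.
  by rewrite invr_gt0 ltr0n/= invf_le1 ?ltr0n// ler1n.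
have a1 k : 1 <= a k by move: (kV k); rewrite /a; move: (_^-1) => y /andP[? ?]; lra.
have a0 k : 0 < a k by apply: lt_le_trans (a1 k).
have a2 k : a k <= 2 by move: (kV k); rewrite /a; move: (_^-1) => y /andP[? ?]; lra.
exists (fun k => a k.+1 / a k); split=> [k|m n].
  rewrite ltr_pdivlMr// mul1r /a ltrD2l ltrN2 ltf_pV2 ?posrE ?ltr0n//.
  by rewrite ltr_nat.
have [nm|mn] := leqP n m; first by rewrite big_geq// ler1n.
have -> : \prod_(m <= k < n) (a k.+1 / a k) = a n / a m.
  rewrite -(subnKC (ltnW mn)); elim: (n - m)%N => [|d ih].
    by rewrite addn0 big_geq// divff// gt_eqF.
  rewrite addnS big_nat_recr ?leq_addr//= ih mulrC mulrA divfK// gt_eqF//.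
by rewrite ler_pdivrMr//; apply: le_trans (a2 n) _; rewrite ler_peMr.
Qed.

(** The basis is cut at indices [b k] such that pairs beyond [b k] obey the
    two-term estimate with a constant [C k]; as the products of the [C k] are
    bounded, the l_p estimate holds for vectors taken from successive pieces. *)
Lemma block_estimate : pairs_lp x p -> exists (D : R) (b : nat -> nat),
  [/\ 1 <= D, b 0%N = 0%N, forall k, (b k < b k.+1)%N &
    forall (z : nat -> X) m n, (forall k, inspan x (b k) (b k.+1) (z k)) ->
      within D `|\sum_(m <= k < n) z k| (lpn p (fun k => `|z k|) m n)].
Proof.
move=> hp; have [C [C1 C2]] := bounded_products.
have /choice [M hM] := fun k => hp (C k) (C1 k).
have [K K0 hK] := proj_bound hx.
pose b := fix b k := if k is k'.+1 then maxn (b k').+1 (M k) else 0%N.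
have bS k : (b k < b k.+1)%N by rewrite /= leq_max leqnn.
have b_le : {homo b : m n / (m <= n)%N}.
  by apply: homo_leq => // [i j l|i]; [exact: leq_trans|exact: ltnW].
pose D0 := 2 + K * lp2 p 1 1.
have l0 : 0 <= lp2 p 1 1 by exact: lp2_ge0.
have D02 : 2 <= D0 by rewrite lerDl mulr_ge0// ltW.
have D0p : 0 < D0 by apply: lt_le_trans D02.
pose C' k := if k is 0 then D0 else C k.
have C'1 k : 1 <= C' k by case: k => [|k] /=; [lra|exact: ltW].
have D2 : 1 <= 2 * D0 by lra.
exists (2 * D0), b; split=> // z m n hz.
have prodC' : \prod_(m <= k < n) C' k <= 2 * D0.
  case: m => [|m]; last first.
    have -> : \prod_(m.+1 <= k < n) C' k = \prod_(m.+1 <= k < n) C k.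
      by apply: eq_big_nat => -[|k].
    by apply: le_trans (C2 _ _) _; lra.
  have [->|n0] := posnP n; first by rewrite big_geq.
  rewrite big_ltn//= mulrC ler_pM2r//.
  have -> : \prod_(1 <= k < n) C' k = \prod_(1 <= k < n) C k.
    by apply: eq_big_nat => -[|k].
  exact: C2.
apply: (within_le _ prodC'); first by apply: lt_le_trans (prod_ge1 _ _ C'1).
  exact: lpn_ge0.
apply: iterate_lp2 => // k /andP[mk kn].
have hw : inspan x (b k.+1) (b n) (\sum_(k.+1 <= j < n) z j).
  rewrite big_seq; apply: inspan_sum => // j; rewrite mem_index_iota => /andP[kj jn].
  by apply: inspan_sub (hz j); apply: b_le.
case: k mk kn hw => [|k] mk kn hw; last first.
  apply: (hM k.+1 _ _ (b k.+2) (b n)) => //.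
  by apply: inspan_sub (hz k.+1) => //; rewrite /= leq_maxr.
move: hw; set w := \sum_(_ <= j < _) _ => hw; set u := z 0%N.
(* Pairs that start in the first piece are only controlled by the basis
   projections; this costs the constant D0. *)
have uE : u = proj x 0 (b 1%N) (u + w).
  apply: (coord_inj hx) => i; rewrite coord_psum// coordDE//.
  have [h|h] := boolP (0 <= i < b 1%N)%N; last exact: (hz 0%N i h).
  by rewrite (hw i) ?addr0// negb_and -ltnNge (andP h).2.
have wE : w = proj x (b 1%N) (b n) (u + w).
  apply: (coord_inj hx) => i; rewrite coord_psum// coordDE//.
  have [h|h] := boolP (b 1%N <= i < b n)%N; last exact: (hw i h).
  by rewrite (hz 0%N i) ?add0r// negb_and -leqNgt (andP h).1.
have hu : `|u| <= K * `|u + w| by rewrite [in leLHS]uE.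
have hw' : `|w| <= K * `|u + w| by rewrite [in leLHS]wE.
have l2 : lp2 p `|u| `|w| <= D0 * `|u + w|.
  apply: (@le_trans _ _ (lp2 p (K * `|u + w| * 1) (K * `|u + w| * 1))).
    have Kn : 0 <= K * `|u + w| by rewrite mulr_ge0// ltW.
    by apply: lp2_le => //; rewrite normr_id mulr1 ger0_norm.
  rewrite lp2Z//; last by rewrite mulr_ge0// ltW.
  by rewrite mulrAC ler_wpM2r// lerDr.
split; first by rewrite ler_pdivrMl.
apply: le_trans (ler_normD _ _) _.
have := lp2_max `|u| `|w| p1; rewrite ge_max !normr_id => /andP[h1 h2].
apply: (@le_trans _ _ (2 * lp2 p `|u| `|w|)); first by lra.
by rewrite ler_wpM2r// lp2_ge0.
Qed.

(** The vector with coordinates [a] on the indices in [m, q). *)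
Definition block_sum m q (a : 'I_(q - m) -> R) : X :=
  \sum_(i < q - m) a i *: x (m + i).

Lemma sum_shift m q (f : nat -> X) :
  \sum_(m <= j < q) f j = \sum_(i < q - m) f (m + i)%N.
Proof.
rewrite -{1}[m]add0n big_addn big_mkord.
by apply: eq_bigr => i _; rewrite addnC.
Qed.

Lemma block_sumE m q (a : 'I_(q - m) -> R) : block_sum a =
  \sum_(m <= j < q) (if insub (j - m)%N is Some i then a i else 0) *: x j.
Proof.
by rewrite sum_shift; apply: eq_bigr => i _; rewrite addKn valK.
Qed.

Lemma coord_block_sum m q (a : 'I_(q - m) -> R) (i : 'I_(q - m)) :
  coord x (block_sum a) (m + i)%N = a i.
Proof.
rewrite block_sumE coord_psum// addKn valK leq_addr/=.
by case: ifPn => //; rewrite -ltn_subRL ltn_ord.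
Qed.

Lemma inspan_block_sum m q (a : 'I_(q - m) -> R) : inspan x m q (block_sum a).
Proof. by move=> i hi; rewrite block_sumE coord_psum// (negbTE hi). Qed.

Lemma block_sum_coord m q v :
  block_sum (fun i : 'I_(q - m) => coord x v (m + i)%N) = proj x m q v.
Proof. by rewrite /proj sum_shift. Qed.

Lemma block_coord_norm m q : exists N : coord_norm R (q - m),
  forall a, N a = `|block_sum a|.
Proof.
pose n := (q - m)%N.
pose S (a : 'I_n -> R) : X := block_sum a.
have D a b : `|S (fun i => a i + b i)| <= `|S a| + `|S b|.
  apply: le_trans (ler_normD _ _); rewrite /S /block_sum -big_split/=.
  by under eq_bigr do rewrite scalerDl.
have Z t a : `|S (fun i => t * a i)| = `|t| * `|S a|.
  rewrite -normrZ /S /block_sum scaler_sumr; congr `|_|.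
  by apply: eq_bigr => i _; rewrite scalerA.
have /choice [c cP] : forall i : 'I_n, exists c : R, 0 < c /\
    forall v, `|coord x v (m + i)%N| <= c * `|v|.
  by move=> i; have [c c0 hc] := coord_bound hx (m + i); exists c.
have B (a : 'I_n -> R) i : `|a i| <= (\sum_i c i) * `|S a|.
  have := (cP i).2 (S a); rewrite coord_block_sum => /le_trans; apply.
  rewrite ler_wpM2r// (bigD1 i)//= lerDl; apply: sumr_ge0 => j _.
  exact: ltW (cP j).1.
by exists (@CoordNorm R n (fun a => `|S a|) _ D Z B).
Qed.

(** The spaces are the spans of the pieces, with the norm of [X].  A vector is
    mapped to its components, and a sequence in the sum is the image of the sum
    of the series of its terms, which converges by the estimate. *)
Lemma pairs_lp_decomposition : pairs_lp x p ->
  exists F : nat -> completeNormedModType R,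
    (forall k, finite_dim (F k)) /\ isomorphic_to_sum X p F.
Proof.
move=> hp; have [D [b [D1 b0 bS hD]]] := block_estimate hp.
have D0 : 0 < D by apply: lt_le_trans D1.
have b_le : {homo b : m n / (m <= n)%N}.
  by apply: homo_leq => // [i j l|i]; [exact: leq_trans|exact: ltnW].
have b_ge k : (k <= b k)%N by elim: k => // k /leq_ltn_trans; apply.
pose N k := sval (cid (block_coord_norm (b k) (b k.+1))).
have NE k a : N k a = `|block_sum a| := svalP (cid (block_coord_norm (b k) (b k.+1))) a.
pose F k : completeNormedModType R := normed_coord (N k).
pose emb k (f : F k) : X := block_sum (ncentry f).
have emb_norm k (f : F k) : `|emb k f| = `|f| by rewrite -NE ncnormE.
have emb_in k (f : F k) : inspan x (b k) (b k.+1) (emb k f) by exact: inspan_block_sum.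
have /(_ _)/cid Tex k : exists T : {linear X -> F k},
    forall v, T v = ncvec (N k) (fun i => coord x v (b k + i)%N).
  apply: linear_bundle => t u v; apply: ncentryP => i.
  by rewrite ncentryD ncentryZ !ncvecE coordD// coordZ.
pose T k := sval (Tex k).
have TE k v i : ncentry (T k v) i = coord x v (b k + i)%N.
  by rewrite (svalP (Tex k)) ncvecE.
have embT k v : emb k (T k v) = proj x (b k) (b k.+1) v.
  rewrite -block_sum_coord /emb; congr block_sum; apply/funext => i; exact: TE.
have sumT n v : \sum_(0 <= k < n) emb k (T k v) = proj x 0 (b n) v.
  elim: n => [|n ih]; first by rewrite big_geq// b0 /proj big_geq.
  rewrite big_nat_recr//= ih embT /proj [RHS](big_cat_nat (n := b n))//=.
  exact: b_le.
have estT v m n : within D `|\sum_(m <= k < n) emb k (T k v)|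
    (lpn p (fun k => `|T k v|) m n).
  have := hD (fun k => emb k (T k v)) m n (fun k => emb_in k _).
  by rewrite (@eq_lpn _ _ _ (fun k => `|T k v|))// => i _; rewrite emb_norm.
have [K K0 hK] := proj_bound hx.
have up v : (sum_norm p (fun k => T k v) <= (D * K * `|v|)%:E)%E.
  apply: Lnorm_le_lpn => // n.
  have [h _] := estT v 0%N n; move: h; rewrite sumT ler_pdivrMl// => /le_trans; apply.
  by rewrite -mulrA ler_pM2l.
have DK : 0 < D * K by rewrite mulr_gt0.
exists F; split=> [k|]; first by exists (b k.+1 - b k)%N, (ncbasis (N k)); exact: ncbasisP.
exists T; split.
- move=> v; split; first by apply: le_lt_trans (up v) _; rewrite ltry.
  move=> _; apply/cvgrPdist_lt => e e0.
  have e2 : 0 < e / 2 by rewrite divr_gt0.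
  have [n0 hn0] := proj_cvg hx v e2; exists n0 => // k /= nk.
  rewrite sub0r normrN normr_id -emb_norm embT.
  have -> : proj x (b k) (b k.+1) v = proj x 0 (b k.+1) v - proj x 0 (b k) v.
    by rewrite /proj [X in X - _](big_cat_nat (n := b k))//= ?b_le// addrAC subrr add0r.
  have h1 := hn0 (b k) (leq_trans nk (b_ge k)).
  have h2 := hn0 (b k.+1) (leq_trans nk (leq_trans (leqnSn k) (b_ge k.+1))).
  apply: le_lt_trans (ler_distD v _ _) _.
  by rewrite distrC (splitr e) ltrD.
- move=> f [ffin fy].
  have est m n : `|\sum_(m <= k < n) emb k (f k)| <= D * lpn p (fun k => `|f k|) m n.
    have [_] := hD (fun k => emb k (f k)) m n (fun k => emb_in k _).
    by rewrite (@eq_lpn _ _ _ (fun k => `|f k|))// => i _; rewrite emb_norm.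
  have [|l hl] := @cauchy_lim R X (fun n => \sum_(0 <= k < n) emb k (f k)).
    move=> e e0; have e1 : 0 < e / 2 / D by rewrite !divr_gt0.
    have [m hm] := lpn_tail p1 ffin fy e1; exists m => n mn.
    rewrite distrC [X in X - _](big_cat_nat (n := m))//= addrAC subrr add0r.
    apply: le_lt_trans (est m n) _.
    apply: (@le_lt_trans _ _ (e / 2)); last by rewrite ltr_pdivrMr// ltr_pMr// ltr1n.
    by rewrite mulrC -ler_pdivlMr// hm.
  exists l => k; apply: ncentryP => i; rewrite TE; apply: coord_lim => // e e0.
  have [n0 hn0] := hl e e0; pose n := maxn n0 k.+1.
  exists (\sum_(0 <= k < n) emb k (f k)); first by apply: hn0; exact: leq_maxl.
  rewrite coord_sum// (bigD1_seq k) ?iota_uniq ?mem_index_iota ?leq_maxr//=.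
  rewrite /emb coord_block_sum big1 ?addr0// => j jk.
  apply: (@emb_in j); rewrite negb_and -ltnNge -leqNgt.
  have ik : (b k + i < b k.+1)%N by rewrite -ltn_subRL ltn_ord.
  move: jk; rewrite neq_ltn => /orP[jk|kj]; apply/orP; [right|left].
    by apply: leq_trans (leq_addr _ _); apply: b_le.
  by apply: leq_trans ik _; apply: b_le.
exists (D * K + D); first by rewrite addr_gt0.
move=> v; split; last first.
  by apply: le_trans (up v) _; rewrite lee_fin ler_wpM2r// lerDl ltW.
have S0 : (0 <= sum_norm p (fun k => T k v))%E by exact: Lnorm_ge0.
have Sfin : sum_norm p (fun k => T k v) \is a fin_num.
  by rewrite ge0_fin_numE//; apply: le_lt_trans (up v) _; rewrite ltry.
rewrite -(fineK Sfin) lee_fin; set S := fine _.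
have Sge n : lpn p (fun k => `|T k v|) 0 n <= S.
  by rewrite -lee_fin fineK//; exact: lpn_le_Lnorm.
have Sp : 0 <= S by apply: le_trans (Sge 0%N); exact: lpn_ge0.
rewrite ler_pdivrMl ?addr_gt0//.
apply: (@le_trans _ _ (D * S)); last by rewrite ler_wpM2r// lerDr ltW.
apply/ler_addgt0Pl => e e0; have [n0 hn0] := proj_cvg hx v e0.
have h1 := hn0 (b n0) (b_ge n0); have [_ h2] := estT v 0%N n0.
rewrite sumT in h2.
rewrite -[X in `|X|](subrK (proj x 0 (b n0) v)).
apply: le_trans (ler_normD _ _) _; apply: lerD; first exact: ltW.
by apply: le_trans h2 _; rewrite ler_pM2l.
Qed.

End Decomposition.

(** * Good block sequences and stabilized asymptotic l_p spaces *)

Unset Implicit Arguments.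

Theorem theoremB (R : realType) (X : completeNormedModType R) (x : nat -> X)
    (hx : schauder_basis x) :
  ((forall y : nat -> X, block_seq x y -> normalized y -> good y) <->
   (exists p : \bar R, (1 <= p)%E /\ stabilized_asymptotic_lp x 1 p)) /\
  (forall p : \bar R, (1 <= p)%E -> stabilized_asymptotic_lp x 1 p ->
     exists F : nat -> completeNormedModType R,
       (forall k, finite_dim (F k)) /\ isomorphic_to_sum X p F).
Proof.
split; first split.
- move=> hg; have [p [p1 hp]] := good_pairs_lp hx hg.
  by exists p; split=> //; apply: tuples_stabilized => //; apply: pairs_tuples_lp.
- move=> [p [p1 /stabilized_tuples hS]]. exact: tuples_good hx _ hS.
- move=> p p1 /stabilized_tuples /(tuples_pairs_lp hx p1).
  exact: pairs_lp_decomposition.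
Qed.
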